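(* The embedding of universal enveloping algebras $$\iota:U(\mathfrak{sl}_2)\hookrightarrow U(\mathfrak{sl}_3),\quad e^rh^sf^t\mapsto x_\alpha^rx^sx_{-\alpha}^t,\quad r,s,t\in\mathbb N,$$ induces an injective homomorphism $\pi$ between Zhu algebras $$\pi:A(V_{A_1})\cong U(\mathfrak{sl}_2)/\langle e^2\rangle\hookrightarrow U(\mathfrak{sl}_3)/\langle x_{\alpha+\beta}^2\rangle=A(V_{A_2}),\qquad e\mapsto x_\alpha,\quad f\mapsto x_{-\alpha},\quad h\mapsto h_\alpha,$$ where the same notation is used for the images of elements in the quotients.
   Context: $\mathfrak{sl}_2=\mathbb Ce+\mathbb Ch+\mathbb Cf$ with its standard basis. $A_2=\mathbb Z\alpha\oplus\mathbb Z\beta$ is the root lattice, $(\alpha|\alpha)=(\beta|\beta)=2$, $(\alpha|\beta)=-1$. $\mathfrak{sl}_3=\mathrm{span}\{x_{\pm\alpha},x_{\pm\beta},x_{\pm(\alpha+\beta)},x,y\}$ is a Chevalley-type basis with $x=h_\alpha$, $y=h_\beta$, $[x_\alpha,x_{-\alpha}]=x$, $[x_\beta,x_{-\beta}]=y$, $[x_\alpha,x_\beta]=x_{\alpha+\beta}$, $[x_{-\alpha},x_{-\beta}]=x_{-(\alpha+\beta)}$. $\langle e^2\rangle$ and $\langle x_{\alpha+\beta}^2\rangle$ denote two-sided ideals of $U(\mathfrak{sl}_2)$, $U(\mathfrak{sl}_3)$. $V_{A_1}\cong L_{\widehat{\mathfrak{sl}_2}}(1,0)$ and $V_{A_2}\cong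 L_{\widehat{\mathfrak{sl}_3}}(1,0)$ are the lattice (level-one simple affine) VOAs attached to $A_1=\mathbb Z\alpha\subset A_2$. Their Zhu algebras are known to be $A(V_{A_1})\cong U(\mathfrak{sl}_2)/\langle e^2\rangle$ and $A(V_{A_2})\cong U(\mathfrak{sl}_3)/\langle x_{\alpha+\beta}^2\rangle$, with $[a(-1)\mathbf 1]\leftrightarrow a$ for $a$ in the Lie algebra. The (non-conformal) VOA embedding $V_{A_1}\hookrightarrow V_{A_2}$ is $e(-1)\mathbf 1\mapsto x_\alpha(-1)\mathbf 1$, $f(-1)\mathbf 1\mapsto x_{-\alpha}(-1)\mathbf 1$, $h(-1)\mathbf 1\mapsto x(-1)\mathbf 1$, and $\pi$ is the homomorphism of Zhu algebras it induces. *)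

(* Defs.v *)
From HB Require Import structures.
From mathcomp Require Import all_boot all_order all_algebra.
From mathcomp Require Import boolp classical_sets functions cardinality fsbigop reals.
From mathcomp Require Import generic_quotient ring_quotient.
From mathcomp Require Import finmap.
From mathcomp.multinomials Require Import monalg.
From mathcomp.real_closed Require Import complex.

Set Implicit Arguments.
Unset Strict Implicit.
Unset Printing Implicit Defensive.

Import GRing.Theory Num.Theory.

Local Open Scope ring_scope.
Local Open Scope classical_set_scope.
Local Open Scope quotient_scope.

Section LinearQuotient.
Variables (K : fieldType) (L : lmodType K).

Inductive span (S : set L) : L -> Prop :=
| span0 : span S 0
| spanZD (c : K) (s x : L) : S s -> span S x -> span S (c *: s + x).

Lemma span_gen (S : set L) s : S s -> span S s.
Proof. by move=> Ss; rewrite -[s]addr0 -[s]scale1r; apply/spanZD/span0. Qed.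

Lemma spanD (S : set L) x y : span S x -> span S y -> span S (x + y).
Proof.
elim=> [|c s z Ss _ IH] Sy; first by rewrite add0r.
by rewrite -addrA; apply: spanZD => //; apply: IH.
Qed.

Lemma spanZ (S : set L) c x : span S x -> span S (c *: x).
Proof.
elim=> [|d s z Ss _ IH]; first by rewrite scaler0; exact: span0.
by rewrite scalerDr scalerA; exact: spanZD.
Qed.

Variable S : set L.

Definition span_pred : {pred L} := fun x => `[< span S x >].

Lemma span_predP x : reflect (span S x) (x \in span_pred).
Proof. exact: asboolP. Qed.

Lemma span_pred_zmod_closed : zmod_closed span_pred.
Proof.
split=> [|x y /span_predP Sx /span_predP Sy]; apply/span_predP.
  exact: span0.
by apply: spanD => //; rewrite -scaleN1r; apply: spanZ.
Qed.

HB.instance Definition _ :=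
  GRing.isZmodClosed.Build L span_pred span_pred_zmod_closed.

Definition lquot : Type := Quotient.quot span_pred.

HB.instance Definition _ := EqQuotient.on lquot.
HB.instance Definition _ := GRing.Zmodule.on lquot.

Definition lclass (x : L) : lquot := \pi_lquot x.

Lemma lclassP x y : (lclass x = lclass y) <-> span S (x - y).
Proof.
split=> [/eqP|/span_predP Sxy]; first by rewrite -Quotient.idealrBE => /span_predP.
by apply/eqP; rewrite -Quotient.idealrBE.
Qed.

Lemma lclass_repr (u : lquot) : lclass (repr u) = u.
Proof. exact: reprK. Qed.

Lemma lclassB : {morph lclass : x y / x - y}.
Proof.
move=> x y; rewrite /lclass; have -> : \pi_lquot (x - y) =
  Quotient.add (\pi_lquot x) (\pi_lquot (- y)) by exact: Quotient.pi_add.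
congr Quotient.add; exact: Quotient.pi_opp.
Qed.

Definition lquot_scale (c : K) (u : lquot) : lquot := lclass (c *: repr u).

Lemma lquot_scaleE c x : lquot_scale c (lclass x) = lclass (c *: x).
Proof.
by apply/lclassP; rewrite -scalerBr; apply/spanZ/lclassP; rewrite lclass_repr.
Qed.

HB.instance Definition _ := GRing.isZmodMorphism.Build L lquot lclass lclassB.

Fact lquot_scaleA a b u :
  lquot_scale a (lquot_scale b u) = lquot_scale (a * b) u.
Proof. by rewrite -[u]lclass_repr !lquot_scaleE scalerA. Qed.

Fact lquot_scale1 : left_id 1 lquot_scale.
Proof. by move=> u; rewrite -[u]lclass_repr lquot_scaleE scale1r. Qed.

Fact lquot_scaleDr : right_distributive lquot_scale +%R.
Proof.
move=> a u v; rewrite -[u]lclass_repr -[v]lclass_repr -raddfD !lquot_scaleE.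
by rewrite scalerDr raddfD.
Qed.

Fact lquot_scaleDl u : {morph lquot_scale^~ u : a b / a + b}.
Proof.
by move=> a b; rewrite -[u]lclass_repr !lquot_scaleE scalerDl raddfD.
Qed.

HB.instance Definition _ := GRing.Zmodule_isLmodule.Build K lquot
  lquot_scaleA lquot_scale1 lquot_scaleDr lquot_scaleDl.

Fact lclass_scalable : scalable lclass.
Proof. by move=> c x; rewrite -lquot_scaleE. Qed.

HB.instance Definition _ :=
  GRing.isScalable.Build K L lquot *:%R lclass lclass_scalable.

End LinearQuotient.

Section IdealQuotient.
Variables (K : fieldType) (A : algType K).

(* The two-sided ideal generated by [S] is the span of these products. *)
Definition ideal_products (S : set A) : set A :=
  [set x | exists a s b, S s /\ x = a * s * b].

Definition ideal (S : set A) : set A := span (ideal_products S).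

(* Generators of a proper ideal: in the library the unit of an algebra is
   nonzero, so only proper ideals have a quotient algebra. *)
Record proper_gens := ProperGens {
  gens :> set A;
  gens_proper : ~ ideal gens 1
}.

Lemma ideal_gen (S : set A) s : S s -> ideal S s.
Proof. by move=> Ss; apply: span_gen; exists 1, s, 1; rewrite mul1r mulr1. Qed.

Lemma ideal_mull (S : set A) a x : ideal S x -> ideal S (a * x).
Proof.
elim=> [|c _ y [b [s [d [Ss ->]]]] _ IH]; first by rewrite mulr0; exact: span0.
rewrite mulrDr -scalerAr; apply: spanZD => //.
by exists (a * b), s, d; rewrite !mulrA.
Qed.

Lemma ideal_mulr (S : set A) a x : ideal S x -> ideal S (x * a).
Proof.
elim=> [|c _ y [b [s [d [Ss ->]]]] _ IH]; first by rewrite mul0r; exact: span0.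
rewrite mulrDl -scalerAl; apply: spanZD => //.
by exists b, s, (d * a); rewrite !mulrA.
Qed.

Variable S : proper_gens.

Definition aquot : Type := lquot (ideal_products S).

HB.instance Definition _ := GRing.Lmodule.on aquot.

Definition aclass (x : A) : aquot := lclass (ideal_products S) x.

HB.instance Definition _ := GRing.isZmodMorphism.Build A aquot aclass
  (@lclassB _ _ (ideal_products S)).
HB.instance Definition _ := GRing.isScalable.Build K A aquot *:%R aclass
  (@lclass_scalable _ _ (ideal_products S)).

Lemma aclassP x y : aclass x = aclass y <-> ideal S (x - y).
Proof. exact: lclassP. Qed.

Definition aquot_repr (u : aquot) : A := repr (u : lquot _).

Lemma aclass_repr u : aclass (aquot_repr u) = u.
Proof. exact: lclass_repr. Qed.

Definition aquot_mul (u v : aquot) : aquot :=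
  aclass (aquot_repr u * aquot_repr v).

Lemma aquot_mulE x y : aquot_mul (aclass x) (aclass y) = aclass (x * y).
Proof.
apply/aclassP; set x' := aquot_repr _; set y' := aquot_repr _.
have -> : x' * y' - x * y = (x' - x) * y' + x * (y' - y).
  by rewrite mulrBl mulrBr addrA subrK.
by apply: spanD; [apply: ideal_mulr | apply: ideal_mull];
  apply/aclassP; rewrite aclass_repr.
Qed.

Fact aquot_mulA : associative aquot_mul.
Proof.
move=> u v w; rewrite -[u]aclass_repr -[v]aclass_repr -[w]aclass_repr.
by rewrite !aquot_mulE mulrA.
Qed.

Fact aquot_mul1 : left_id (aclass 1) aquot_mul.
Proof. by move=> u; rewrite -[u]aclass_repr aquot_mulE mul1r. Qed.

Fact aquot_mulr1 : right_id (aclass 1) aquot_mul.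
Proof. by move=> u; rewrite -[u]aclass_repr aquot_mulE mulr1. Qed.

Fact aquot_mulDl : left_distributive aquot_mul +%R.
Proof.
move=> u v w; rewrite -[u]aclass_repr -[v]aclass_repr -[w]aclass_repr.
by rewrite -raddfD !aquot_mulE mulrDl raddfD.
Qed.

Fact aquot_mulDr : right_distributive aquot_mul +%R.
Proof.
move=> u v w; rewrite -[u]aclass_repr -[v]aclass_repr -[w]aclass_repr.
by rewrite -raddfD !aquot_mulE mulrDr raddfD.
Qed.

Fact aquot_one_neq0 : aclass 1 != 0.
Proof.
apply/eqP; rewrite -[X in _ = X](raddf0 aclass) => /aclassP.
by rewrite subr0; exact: gens_proper.
Qed.

HB.instance Definition _ := GRing.Zmodule_isNzRing.Build aquot
  aquot_mulA aquot_mul1 aquot_mulr1 aquot_mulDl aquot_mulDr aquot_one_neq0.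

Fact aclass_monoid_morphism : monoid_morphism aclass.
Proof.
split=> // x y; apply/esym; exact: aquot_mulE.
Qed.

HB.instance Definition _ :=
  GRing.isMonoidMorphism.Build A aquot aclass aclass_monoid_morphism.

Fact aquot_scaleAl (c : K) (u v : aquot) : c *: (u * v) = (c *: u) * v.
Proof.
rewrite -[u]aclass_repr -[v]aclass_repr.
by rewrite -rmorphM -!linearZ -?rmorphM /= scalerAl.
Qed.

HB.instance Definition _ :=
  GRing.Lmodule_isLalgebra.Build K aquot aquot_scaleAl.

Fact aquot_scaleAr (c : K) (u v : aquot) : c *: (u * v) = u * (c *: v).
Proof.
rewrite -[u]aclass_repr -[v]aclass_repr.
by rewrite -rmorphM -!linearZ -?rmorphM /= scalerAr.
Qed.

HB.instance Definition _ := GRing.Lalgebra_isAlgebra.Build K aquot aquot_scaleAr.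

End IdealQuotient.

HB.mixin Record isLieAlg (K : fieldType) L of GRing.Lmodule K L := {
  lie : L -> L -> L;
  lie_linear_l : forall y, linear (lie^~ y);
  lie_linear_r : forall x, linear (lie x);
  lie_alternating : forall x, lie x x = 0;
  lie_jacobi : forall x y z,
    lie x (lie y z) + lie y (lie z x) + lie z (lie x y) = 0
}.

#[short(type="lieAlgType")]
HB.structure Definition LieAlg (K : fieldType) :=
  {L of GRing.Lmodule K L & isLieAlg K L}.

Section EnvelopingAlgebra.
Variables (K : fieldType) (L : lieAlgType K).

(* The free associative algebra on the underlying set of [L]: words in the
   elements of [L]. The linear structure of [L] is restored by the relations. *)
Definition freealg : Type := {malg K[{fmonom L}]}.

HB.instance Definition _ := GRing.Lalgebra.on freealg.

Definition letter (x : L) : freealg := << fmu x >>.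

Fact freealg_scaleAr (c : K) (u v : freealg) : c *: (u * v) = u * (c *: v).
Proof.
have cC (w : freealg) : w * c%:MP = c%:MP * w :> freealg.
  apply/malgP=> k; rewrite mul_malgC mcoeffZ.
  rewrite (@mcoeffMlw _ _ (msupp w) [fset mone]%fset) //; last exact: msuppC_le.
  rewrite [in RHS](monalgE w) raddf_sum mulr_sumr; apply: eq_bigr => m _.
  rewrite big_seq_fset1 mulm1 mcoeffC eqxx mulr1n /=.
  by rewrite mcoeffU mulrnAr mulrC.
by rewrite -!mul_malgC mulrA -(cC u) mulrA.
Qed.

HB.instance Definition _ :=
  GRing.Lalgebra_isAlgebra.Build K freealg freealg_scaleAr.

Definition env_relations : set freealg :=
  [set r | (exists (c : K) (x y : L),
              r = letter (c *: x + y) - (c *: letter x + letter y))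
        \/ (exists x y : L,
              r = letter x * letter y - letter y * letter x
                  - letter (lie x y))].

Definition free_counit (u : freealg) : K := mcoeff mone u.

Fact free_counit_monoid_morphism : monoid_morphism free_counit.
Proof. by case: (mcoeff1g_is_multiplicative {fmonom L} K). Qed.

Fact free_counit_scalable : scalable_for *%R free_counit.
Proof. by move=> c u; exact: mcoeffZ. Qed.

HB.instance Definition _ := GRing.isZmodMorphism.Build freealg K free_counit
  (raddfB (mcoeff mone)).
HB.instance Definition _ := GRing.isMonoidMorphism.Build freealg K free_counit
  free_counit_monoid_morphism.
HB.instance Definition _ := GRing.isScalable.Build K freealg K *%R free_counit
  free_counit_scalable.

Lemma free_counit_letter x : free_counit (letter x) = 0.
Proof. by rewrite /free_counit /letter mcoeffU1 -fdeg_eq0 fdegU. Qed.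

Lemma free_counit_ideal u : ideal env_relations u -> free_counit u = 0.
Proof.
elim=> [|c _ y [a [r [b [Sr ->]]]] _ IH]; first exact: raddf0.
rewrite raddfD /= IH addr0 linearZ /= !rmorphM /=.
suff -> : free_counit r = 0 by rewrite mulr0 mul0r mulr0.
case: Sr => [[d [x [z ->]]]|[x [z ->]]].
  by rewrite raddfB /= raddfD /= linearZ /= !free_counit_letter mulr0 addr0 subrr.
by rewrite !raddfB /= !rmorphM /= !free_counit_letter !mulr0 !subr0.
Qed.

Fact env_proper : ~ ideal env_relations 1.
Proof. by move=> /free_counit_ideal /eqP; rewrite rmorph1 oner_eq0. Qed.

Definition env_gens : proper_gens freealg := ProperGens env_proper.

Definition envalg : algType K := aquot env_gens.

Definition env (x : L) : envalg := aclass env_gens (letter x).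

Definition env_counit (u : envalg) : K := free_counit (aquot_repr u).

Lemma env_counitE u : env_counit (aclass env_gens u) = free_counit u.
Proof.
apply/eqP; rewrite -subr_eq0 -raddfB; apply/eqP/free_counit_ideal.
by apply/(aclassP env_gens); rewrite aclass_repr.
Qed.

Lemma env_counitM : {morph env_counit : u v / u * v}.
Proof.
move=> u v; have := env_counitE (aquot_repr u * aquot_repr v).
by rewrite (rmorphM (aclass env_gens)) /= !aclass_repr => ->; exact: rmorphM.
Qed.

Lemma env_counitZD c : {morph env_counit : u v / c *: u + v >-> c * u + v}.
Proof.
move=> u v; have := env_counitE (c *: aquot_repr u + aquot_repr v).
rewrite (linearP (aclass env_gens)) /= !aclass_repr => ->.
by rewrite raddfD /= linearZ.
Qed.

Fact sqr_proper (x : L) : ~ ideal [set env x ^+ 2] 1.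
Proof.
suff ker u : ideal [set env x ^+ 2] u -> env_counit u = 0.
  move=> /ker; have := env_counitE 1.
  rewrite (rmorph1 (aclass env_gens)) rmorph1 => -> /eqP.
  by rewrite oner_eq0.
have counit0 : env_counit 0 = 0.
  by have := env_counitE 0; rewrite (raddf0 (aclass env_gens)) raddf0.
elim=> [//|c _ y [a [r [b [-> ->]]]] _ IH].
rewrite env_counitZD !env_counitM IH /env env_counitE free_counit_letter.
by rewrite !(mulr0, mul0r) addr0.
Qed.

(* <x^2>, the two-sided ideal of the enveloping algebra generated by x^2 *)
Definition sqr_gens (x : L) : proper_gens envalg := ProperGens (@sqr_proper x).

End EnvelopingAlgebra.

Section SpecialLinear.
Variables (K : fieldType) (n : nat).

Definition traceless : {pred 'M[K]_n} := [pred A | \tr A == 0].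

Fact traceless_submod_closed : submod_closed traceless.
Proof.
split=> [|c A B]; rewrite !inE; first by rewrite raddf0.
by move=> /eqP A0 /eqP B0; rewrite raddfD /= linearZ /= A0 B0 mulr0 addr0.
Qed.

HB.instance Definition _ :=
  GRing.isSubmodClosed.Build K 'M[K]_n traceless traceless_submod_closed.

Record sl := Sl { sl_val :> 'M[K]_n; _ : sl_val \in traceless }.

HB.instance Definition _ := [isSub for sl_val].
HB.instance Definition _ := [Choice of sl by <:].
HB.instance Definition _ := [SubChoice_isSubLmodule of sl by <:].

Fact commutator_traceless (A B : 'M[K]_n) : A *m B - B *m A \in traceless.
Proof. by rewrite inE raddfB /= mxtrace_mulC subrr. Qed.

Definition sl_bracket (A B : sl) : sl := Sl (commutator_traceless A B).

Fact sl_bracket_linear_l B : linear (sl_bracket^~ B).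
Proof.
move=> c X Y; apply: val_inj => /=.
by rewrite mulmxDl mulmxDr -scalemxAl -scalemxAr scalerBr opprD addrACA.
Qed.

Fact sl_bracket_alternating A : sl_bracket A A = 0.
Proof. by apply: val_inj; rewrite /= subrr. Qed.

Fact sl_bracket_linear_r A : linear (sl_bracket A).
Proof.
move=> c X Y; apply: val_inj => /=.
by rewrite mulmxDr mulmxDl -scalemxAl -scalemxAr scalerBr opprD addrACA.
Qed.

Fact sl_bracket_jacobi A B D :
  sl_bracket A (sl_bracket B D) + sl_bracket B (sl_bracket D A)
    + sl_bracket D (sl_bracket A B) = 0.
Proof.
apply: val_inj => /=; rewrite !(mulmxBl, mulmxBr) !mulmxA.
rewrite !opprB !addrA !subrK.
set p := A *m B *m D; set q := A *m D *m B; set r := D *m B *m A.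
set t := B *m A *m D; rewrite (addrAC (p - q + r)) (addrAC (p - q)) subrK.
by rewrite (addrAC (p + r)) addrK subrK subrr.
Qed.

HB.instance Definition _ := isLieAlg.Build K sl
  sl_bracket_linear_l sl_bracket_linear_r sl_bracket_alternating
  sl_bracket_jacobi.

End SpecialLinear.

Section StandardBases.
Variable K : fieldType.

Fact delta_traceless n (i j : 'I_n) :
  i != j -> (delta_mx i j : 'M[K]_n) \in (@traceless K n).
Proof.
move=> ij; rewrite inE /mxtrace big1 // => k _.
by rewrite mxE; case: eqVneq => // ->; rewrite (negbTE ij).
Qed.

Definition sl_delta n (i j : 'I_n) (ij : i != j) : sl K n :=
  Sl (delta_traceless ij).

Definition sl2_e : sl K 2 := @sl_delta 2 0 1 isT.
Definition sl2_f : sl K 2 := @sl_delta 2 1 0 isT.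
Definition sl2_h : sl K 2 := lie sl2_e sl2_f.

Definition sl3_xa : sl K 3 := @sl_delta 3 0 1 isT.    (* x_alpha *)
Definition sl3_xb : sl K 3 := @sl_delta 3 1 2%:R isT. (* x_beta *)
Definition sl3_xma : sl K 3 := @sl_delta 3 1 0 isT.   (* x_(-alpha) *)
Definition sl3_xab : sl K 3 := lie sl3_xa sl3_xb.     (* x_(alpha+beta) *)
Definition sl3_x : sl K 3 := lie sl3_xa sl3_xma.      (* h_alpha *)

End StandardBases.

Definition trace_form (K : fieldType) n (A B : sl K n) : K := \tr (A *m B).

(* [binz m j] is the binomial coefficient m(m-1)...(m-j+1)/j! for m in Z. *)
Definition binz (K : numFieldType) (m : int) (j : nat) : K :=
  (\prod_(i < j) (m - i%:Z)%:~R) / (j`!)%:R.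

(* [vmode a n b] is a_n b, where Y(a,z)b = \sum_n a_n b z^(-n-1). The last
   axiom is the Borcherds (Jacobi) identity; its sums have finite support
   because of [vmode_truncation]. *)
HB.mixin Record isVertexAlg (K : numFieldType) V of GRing.Lmodule K V := {
  vmode : V -> int -> V -> V;
  vac : V;
  vmode_linear_l : forall n b, linear (fun a => vmode a n b);
  vmode_linear_r : forall a n, linear (vmode a n);
  vmode_truncation : forall a b, exists N : int,
    forall n, N <= n -> vmode a n b = 0;
  vac_mode : forall n b, vmode vac n b = if n == -1 then b else 0;
  vmode_vac : forall a, vmode a (-1) vac = a;
  vmode_vac_nneg : forall a (n : nat), vmode a n%:Z vac = 0;
  borcherds : forall a b c (m n k : int),
    \sum_(j \in [set: nat])
        binz K m j *: vmode (vmode a (n + j%:Z) b) (m + k - j%:Z) c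
    = \sum_(j \in [set: nat]) ((-1) ^+ j * binz K n j) *:
        (vmode a (m + n - j%:Z) (vmode b (k + j%:Z) c)
         - (-1) ^ n *: vmode b (n + k - j%:Z) (vmode a (m + j%:Z) c))
}.

#[short(type="vertexAlgType")]
HB.structure Definition VertexAlg (K : numFieldType) :=
  {V of GRing.Lmodule K V & isVertexAlg K V}.

Arguments vac {K s}.

(* Vertex operator algebras graded by the natural numbers. L_n is
   [vmode omega (n + 1)], and [wt_comp n v] is the component of weight n
   of [v]; it is determined by [wt_compP], [wt_comp_finite], [wt_comp_sum]. *)
HB.mixin Record isVOA (K : numFieldType) V of VertexAlg K V := {
  omega : V;
  central_charge : K;
  wt_comp : nat -> V -> V;
  virasoro : forall (m n : int) (v : V),
    vmode omega (m + 1) (vmode omega (n + 1) v)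
    - vmode omega (n + 1) (vmode omega (m + 1) v)
    = (m - n)%:~R *: vmode omega (m + n + 1) v
      + (if m + n == 0 then (m ^+ 3 - m)%:~R / 12%:R * central_charge
         else 0) *: v;
  omega_derivation : forall (a b : V) (n : int),
    vmode (vmode omega 0 a) n b = - (n%:~R *: vmode a (n - 1) b);
  wt_compP : forall n v, vmode omega 1 (wt_comp n v) = n%:R *: wt_comp n v;
  wt_comp_finite : forall v, exists N, forall n, (N <= n)%N -> wt_comp n v = 0;
  wt_comp_sum : forall v, v = \sum_(n \in [set: nat]) wt_comp n v;
  wt_space_finite_dim : forall n, exists s : seq V,
    forall v, vmode omega 1 v = n%:R *: v -> span [set` s] v
}.

#[short(type="voaType")]
HB.structure Definition VOA (K : numFieldType) :=
  {V of VertexAlg K V & isVOA K V}.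

Definition has_wt (K : numFieldType) (V : voaType K) (n : nat) (v : V) : Prop :=
  vmode (omega : V) 1 v = n%:R *: v.

(* Embeddings of vertex algebras; the conformal vector need not be preserved. *)
Record vertex_embedding (K : numFieldType) (V W : voaType K)
    (f : {linear V -> W}) : Prop := {
  emb_injective : injective f;
  emb_vac : f vac = vac;
  emb_mode : forall a n b, f (vmode a n b) = vmode (f a) n (f b)
}.

Section Affine.
Variables (K : numFieldType) (L : lieAlgType K) (form : L -> L -> K).
Variables (V : voaType K) (J : L -> V).

(* The subspace spanned by the J(x1)_n1 ... J(xr)_nr 1. *)
Inductive generated : V -> Prop :=
| generated_vac : generated vac
| generated_linear (c : K) (u v : V) :
    generated u -> generated v -> generated (c *: u + v)
| generated_mode (x : L) (n : int) (v : V) :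
    generated v -> generated (vmode (J x) n v).

(* [V] is the simple affine vertex operator algebra L(k,0) of [L] with respect
   to the invariant form [form], and J(x) = x(-1)1: the modes of the J(x)
   represent the affine Lie algebra at level k and generate V from the vacuum,
   and V is irreducible as a module over itself. As the J(x) have weight 1, the
   conformal vector is the usual one when [L] is simple and k is not critical. *)
Record simple_affine_voa (k : K) : Prop := {
  current_linear : linear J;
  current_wt : forall x, has_wt 1 (J x);
  current_mode0 : forall x y, vmode (J x) 0 (J y) = J (lie x y);
  current_mode1 : forall x y, vmode (J x) 1 (J y) = (k * form x y) *: vac;
  current_mode_ge2 : forall x y (n : nat), (2 <= n)%N ->
    vmode (J x) n%:Z (J y) = 0;
  current_generated : forall v, generated v;
  voa_nonzero : vac <> 0 :> V;
  voa_simple : forall W : set V,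
    W 0 -> (forall c u v, W u -> W v -> W (c *: u + v)) ->
    (forall a n v, W v -> W (vmode a n v)) ->
    (forall v, W v -> v = 0) \/ (forall v, W v)
}.

End Affine.

Section Zhu.
Variables (K : numFieldType) (V : voaType K).

(* For a of weight n, [zhu_residue n d a b] is
   Res_z (1+z)^n z^(-d) Y(a,z)b. *)
Definition zhu_residue (n d : nat) (a b : V) : V :=
  \sum_(i < n.+1) 'C(n, i)%:R *: vmode a (i%:Z - d%:Z) b.

Definition zhu_mul (a b : V) : V :=
  \sum_(n \in [set: nat]) zhu_residue n 1 (wt_comp n a) b.

(* O(V) is the span of the a o b with a homogeneous. *)
Definition zhu_circ : set V :=
  [set x | exists n a b, has_wt n a /\ x = zhu_residue n 2 a b].

Definition zhu : lmodType K := lquot zhu_circ.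

Definition zhu_class (a : V) : zhu := lclass zhu_circ a.

End Zhu.

(* The product of A(V) is [a] [b] = [a * b], where * is [zhu_mul]. Morphisms
   to and between Zhu algebras are required to respect it for all choices of
   representatives. *)
Record morphism_to_zhu (K : numFieldType) (A : algType K) (V : voaType K)
    (phi : {linear A -> zhu V}) : Prop := {
  to_zhu_one : phi 1 = zhu_class vac;
  to_zhu_mul : forall u v a b, phi u = zhu_class a -> phi v = zhu_class b ->
    phi (u * v) = zhu_class (zhu_mul a b)
}.

Record zhu_morphism (K : numFieldType) (V W : voaType K)
    (p : {linear zhu V -> zhu W}) : Prop := {
  zhu_morphism_one : p (zhu_class vac) = zhu_class vac;
  zhu_morphism_mul : forall a b a' b',
    p (zhu_class a) = zhu_class a' -> p (zhu_class b) = zhu_class b' ->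
    p (zhu_class (zhu_mul a b)) = zhu_class (zhu_mul a' b')
}.

(* Main.v *)
Require Import Defs.
From HB Require Import structures.
From mathcomp Require Import all_boot all_order all_algebra.
From mathcomp Require Import boolp classical_sets functions fsbigop reals.
From mathcomp.multinomials Require Import monalg mpoly.
From mathcomp.real_closed Require Import complex.
From mathcomp Require Import ring.

Set Implicit Arguments.
Unset Strict Implicit.
Unset Printing Implicit Defensive.

Import GRing.Theory Num.Theory.
Local Open Scope ring_scope.

(** The block embedding of 2 x 2 matrices as upper left corners of 3 x 3
    matrices is a homomorphism of Lie algebras, so it extends to a homomorphism
    iota of enveloping algebras. Three things have to be seen.

    iota is injective. The ordered monomials h^s e^r f^t span U(sl_2)
    ([env_sl2_ordered]), so it is enough that their images stay linearly
    independent in some representation of sl_3. The vector fields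
    X_i d/dX_j make gl_3 act on K[X_0, X_1, X_2] ([linear_field_comm]), and
    sl_2 acts on binary forms inside it by e X^a Y^b = b X^(a+1) Y^(b-1),
    f X^a Y^b = a X^(a-1) Y^(b+1), h X^a Y^b = (a - b) X^a Y^b. Applying a
    relation between ordered monomials to X^t Y^b, where t is the least
    exponent of f that occurs, isolates polynomials in h that vanish at
    infinitely many points ([eval_action_inj]).

    iota passes to the quotients and stays injective. Applying ad x_(-beta)
    twice to x_(alpha+beta)^2 yields 2 x_alpha^2, so the ideal of x_(alpha+beta)^2
    contains iota(e^2) ([ideal_sqr_lower]). Bracketing e^2 = 0 repeatedly with f
    gives enough relations in U(sl_2)/<e^2> to span it by 1, e, f, h, h^2
    ([sqr0_spanned_mul]), and the natural representation of sl_3, which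
    annihilates x_(alpha+beta)^2, sends these to linearly independent matrices
    ([sqr0_spanned_inj]).

    The map pi so obtained is the one induced by the embedding j of vertex
    algebras. That embedding does not preserve the conformal vector, while the Zhu
    algebra depends on the grading by L_0. But V_(A_1) is generated by the currents
    J(x), which have weight 1 in both algebras, and the commutator of L_0 with a
    mode of a homogeneous vector depends on its weight only; hence j intertwines
    the two operators L_0 ([emb_currents_L0]), carries O(V_(A_1)) into
    O(V_(A_2)) and respects the products ([zhu_map], [emb_zhu_mul]). The induced
    map and pi agree on the classes of currents, and therefore everywhere
    ([zhu_map_square]). *)

(** * Universal properties of quotients and enveloping algebras *)

Section LinearQuotientLift.
Variables (K : fieldType) (V W : lmodType K) (S : set V) (f : {linear V -> W}).
Hypothesis fS : forall s, S s -> f s = 0.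

Lemma span_kernel x : Defs.span S x -> f x = 0.
Proof.
elim=> [|c s y Ss _ IH]; first exact: linear0.
by rewrite linearP IH fS // scaler0 addr0.
Qed.

Lemma lquot_lift : exists g : {linear lquot S -> W},
  forall x, g (lclass S x) = f x.
Proof.
pose g (u : lquot S) : W := f (repr u).
have gE x : g (lclass S x) = f x.
  apply/eqP; rewrite -subr_eq0 -linearB; apply/eqP/span_kernel.
  by apply/lclassP; rewrite lclass_repr.
have g_linear : linear g.
  move=> c u v; rewrite -[u]lclass_repr -[v]lclass_repr -linearP !gE.
  exact: linearP.
pose gL := GRing.isLinear.Build _ _ _ _ g g_linear.
pose G : {linear lquot S -> W} := HB.pack g gL.
by exists G.
Qed.

End LinearQuotientLift.

Section QuotientLift.
Variables (K : fieldType) (A B : algType K) (S : proper_gens A).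
Variable f : {lrmorphism A -> B}.
Hypothesis fS : forall s, gens S s -> f s = 0.

Lemma aquot_lift : exists g : {lrmorphism aquot S -> B},
  forall x, g (aclass S x) = f x.
Proof.
have fP x : ideal_products S x -> f x = 0.
  by move=> [a [s [b [Ss ->]]]]; rewrite !rmorphM /= (fS Ss) mulr0 mul0r.
have [g gE] := lquot_lift fP.
have g_mult : monoid_morphism (g : aquot S -> B).
  split=> [|u v]; first exact: etrans (gE 1) (rmorph1 f).
  by rewrite -[u]aclass_repr -[v]aclass_repr -rmorphM !gE rmorphM.
pose gM := GRing.isMonoidMorphism.Build _ _ (g : aquot S -> B) g_mult.
pose G : {lrmorphism aquot S -> B} := HB.pack (g : aquot S -> B) g gM.
by exists G.
Qed.

End QuotientLift.

Section FreeLift.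
Variables (K : fieldType) (L : lieAlgType K) (B : algType K) (f : L -> B).

Definition word_value (m : {fmonom L}) : B := \prod_(x <- (m : seq L)) f x.

Fact word_value_morph : mmorphism word_value.
Proof.
split=> [m1 m2|]; first by rewrite /word_value fmM big_cat.
by rewrite /word_value fm1 big_nil.
Qed.

HB.instance Definition _ := isMultiplicative.Build _ _ word_value word_value_morph.

Lemma free_lift : exists g : {lrmorphism freealg L -> B},
  forall x, g (letter x) = f x.
Proof.
pose g (u : freealg L) : B := monalg.mmap (in_alg B) word_value u.
have gB : zmod_morphism g by exact: raddfB.
have gZ : scalable g by move=> c u; rewrite /g monalg.mmapZ /= mulr_algl.
have gM : monoid_morphism g.
  have [gM g1] : multiplicative g.
    apply: monalg.commr_mmap_is_multiplicative => u m m'.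
    by rewrite /GRing.comm /= mulr_algl mulr_algr.
  by split.
pose gBm := GRing.isZmodMorphism.Build _ _ g gB.
pose gZm := GRing.isScalable.Build _ _ _ _ g gZ.
pose gMm := GRing.isMonoidMorphism.Build _ _ g gM.
pose G : {lrmorphism freealg L -> B} := HB.pack g gBm gZm gMm.
exists G => x; rewrite /= /g /letter monalg.mmapU /= scale1r mul1r.
by rewrite /word_value fmU big_seq1.
Qed.

End FreeLift.

Section Enveloping.
Variables (K : fieldType) (L : lieAlgType K).
Local Notation U := (envalg L).

Lemma env_linear : linear (@env K L : L -> U).
Proof.
move=> c x y; rewrite /env -linearP; apply/(aclassP (env_gens L)).
by apply: ideal_gen; left; exists c, x, y.
Qed.

HB.instance Definition _ :=
  GRing.isLinear.Build K L U *:%R (@env K L) env_linear.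

Lemma env_lie (x y : L) : env (lie x y) = env x * env y - env y * env x :> U.
Proof.
apply/esym; rewrite /env -!rmorphM -rmorphB; apply/(aclassP (env_gens L)).
by apply: ideal_gen; right; exists x, y.
Qed.

Lemma env_lift (B : algType K) (f : {linear L -> B}) :
    (forall x y, f (lie x y) = f x * f y - f y * f x) ->
  exists g : {lrmorphism U -> B}, forall x, g (env x) = f x.
Proof.
move=> f_lie; have [g gE] := free_lift (f : L -> B).
have gM u v : g (letter u * letter v) = f u * f v by rewrite -!gE; exact: rmorphM.
have gS s : gens (env_gens L) s -> g s = 0.
  case=> [[c [x [y ->]]]|[x [y ->]]].
    by rewrite linearB linearD linearZ /= !gE linearP subrr.
  rewrite raddfB raddfB; apply/eqP; rewrite subr_eq0; apply/eqP.
  transitivity (f x * f y - f y * f x); first by congr (_ - _); exact: gM.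
  by rewrite -f_lie; exact/esym/gE.
have [h hE] := aquot_lift gS.
by exists h => x; rewrite /env hE.
Qed.

(** Every element is a combination of products of elements of the Lie algebra,
    so a linear property may be checked by multiplying by one such element at
    a time, on the left. *)
Lemma env_ind (P : U -> Prop) :
    P 1 -> (forall c u v, P u -> P v -> P (c *: u + v)) ->
    (forall x u, P u -> P (env x * u)) ->
  forall u, P u.
Proof.
move=> P1 PD PM u; rewrite -[u]aclass_repr.
move: (aquot_repr u) => {u} w; rewrite (monalgE w).
elim: (X in \big[_/_]_(_ <- X) _) => [|m s IH].
  by rewrite big_nil raddf0 -(addNr 1) -scaleN1r; exact: PD.
rewrite big_cons raddfD /=.
have -> : << monalg.mcoeff m w *g m >> = monalg.mcoeff m w *: (<< m >> : freealg L).
  by apply/malgP=> k; rewrite monalg.mcoeffZ !monalg.mcoeffU mulrnAr mulr1.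
rewrite (linearZ_LR (aclass (env_gens L))); apply: PD IH.
rewrite -[m]fmK; elim: (m : seq L) => [|x t IHt].
  rewrite -fmoneE; have -> : << fmone L >> = 1 :> freealg L by [].
  by rewrite rmorph1.
have -> : << FMonom (x :: t) >> = letter x * << FMonom t >> :> freealg L.
  rewrite [RHS](fgmulUU 1 1 (fmu x) (FMonom t)) mulr1.
  by rewrite /mmul /= fmuE fmmulE.
by rewrite rmorphM; exact: PM.
Qed.

End Enveloping.

(** * The algebra of linear endomorphisms *)

(** The unit of an algebra is nonzero, so the identity endomorphism differs from
    0, as the unit of a nontrivial ring must. *)
Section Endomorphisms.
Variables (K : fieldType) (V : lalgType K).

Definition linear_pred : {pred V -> V} := fun f => `[< linear f >].

Fact linear_pred_submod_closed : submod_closed linear_pred.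
Proof.
split=> [|c f g /asboolP fL /asboolP gL]; apply/asboolP => a u v.
  by rewrite -[LHS]/(0 : V) -[RHS]/(a *: (0 : V) + 0) scaler0 addr0.
rewrite -[LHS]/(c *: f (a *: u + v) + g (a *: u + v)).
rewrite -[RHS]/(a *: (c *: f u + g u) + (c *: f v + g v)).
by rewrite fL gL !scalerDr !scalerA mulrC addrACA.
Qed.

HB.instance Definition _ := GRing.isSubmodClosed.Build K (V -> V) linear_pred
  linear_pred_submod_closed.

Record endo := Endo { endo_val : V -> V; _ : endo_val \in linear_pred }.

HB.instance Definition _ := [isSub for endo_val].
HB.instance Definition _ := [Choice of endo by <:].
HB.instance Definition _ := [SubChoice_isSubLmodule of endo by <:].

Lemma endo_linear (f : endo) : linear (endo_val f).
Proof. by apply/asboolP; exact: valP f. Qed.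

HB.instance Definition _ (f : endo) :=
  GRing.isLinear.Build K V V *:%R (endo_val f) (endo_linear f).

Lemma endo_scale (f : endo) c v : endo_val f (c *: v) = c *: endo_val f v.
Proof. exact: linearZ. Qed.

Lemma endoP (f g : endo) : endo_val f =1 endo_val g -> f = g.
Proof. by move=> fg; apply: val_inj; apply/funext. Qed.

Fact endo_id_subproof : @id V \in linear_pred.
Proof. exact/asboolP. Qed.

Fact endo_comp_subproof (f g : endo) : endo_val f \o endo_val g \in linear_pred.
Proof. by apply/asboolP => c u v /=; rewrite !linearP. Qed.

Definition endo_one : endo := Endo endo_id_subproof.
Definition endo_mul (f g : endo) : endo := Endo (endo_comp_subproof f g).

Lemma endoDE (f g : endo) v : endo_val (f + g) v = endo_val f v + endo_val g v.
Proof. by []. Qed.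

Fact endo_mulA : associative endo_mul.
Proof. by move=> f g h; apply: endoP. Qed.

Fact endo_mul1 : left_id endo_one endo_mul.
Proof. by move=> f; apply: endoP. Qed.

Fact endo_mulr1 : right_id endo_one endo_mul.
Proof. by move=> f; apply: endoP. Qed.

Fact endo_mulDl : left_distributive endo_mul +%R.
Proof. by move=> f g h; apply: endoP. Qed.

Fact endo_mulDr : right_distributive endo_mul +%R.
Proof. by move=> f g h; apply: endoP => v; rewrite /= linearD. Qed.

Fact endo_one_neq0 : endo_one != 0.
Proof.
apply/eqP => /(congr1 (fun f => endo_val f 1)) /eqP.
by rewrite oner_eq0.
Qed.

HB.instance Definition _ := GRing.Zmodule_isNzRing.Build endo
  endo_mulA endo_mul1 endo_mulr1 endo_mulDl endo_mulDr endo_one_neq0.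

Fact endo_scaleAl (c : K) (f g : endo) : c *: (f * g) = (c *: f) * g.
Proof. by apply: endoP. Qed.

HB.instance Definition _ := GRing.Lmodule_isLalgebra.Build K endo endo_scaleAl.

Fact endo_scaleAr (c : K) (f g : endo) : c *: (f * g) = f * (c *: g).
Proof. by apply: endoP => v; rewrite /= linearZ. Qed.

HB.instance Definition _ := GRing.Lalgebra_isAlgebra.Build K endo endo_scaleAr.

Lemma endoME (f g : endo) v : endo_val (f * g) v = endo_val f (endo_val g v).
Proof. by []. Qed.

Lemma endo1E v : endo_val 1 v = v.
Proof. by []. Qed.

End Endomorphisms.

(** * The action of sl_n on polynomials *)

Section PolynomialAction.
Variables (K : fieldType) (n : nat).
Local Notation P := (mpoly n K).

Lemma mderivXU (i j : 'I_n) : ('X_i : P)^`M(j) = (i == j)%:R.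
Proof.
rewrite mderivX mnm1E; case: eqVneq => [->|_]; last by rewrite scale0r.
rewrite scale1r (_ : (U_(j) - U_(j))%MM = 0%MM) ?mpolyX0 //.
by apply/mnmP => k; rewrite mnmBE mnm0E subnn.
Qed.

(** The vector field whose value at a point depends linearly on the point
    through the matrix A; it extends the action of A on linear forms to a
    derivation of the polynomial ring. *)
Definition linear_field (A : 'M[K]_n) (p : P) : P :=
  \sum_i \sum_j A i j *: ('X_i * p^`M(j)).

Lemma linear_field_linear A : linear (linear_field A).
Proof.
move=> c p q; rewrite /linear_field scaler_sumr -big_split.
apply: eq_bigr => i _; rewrite scaler_sumr -big_split; apply: eq_bigr => j _ /=.
by rewrite mderivD mderivZ mulrDr scalerDr -scalerAr !scalerA mulrC.
Qed.

Lemma linear_field_linear_mx p : linear (linear_field^~ p).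
Proof.
move=> c A B; rewrite /linear_field scaler_sumr -big_split.
apply: eq_bigr => i _; rewrite scaler_sumr -big_split; apply: eq_bigr => j _ /=.
by rewrite !mxE scalerDl scalerA.
Qed.

Lemma linear_fieldM A p q :
  linear_field A (p * q) = linear_field A p * q + p * linear_field A q.
Proof.
rewrite /linear_field mulr_suml mulr_sumr -big_split; apply: eq_bigr => i _.
rewrite mulr_suml mulr_sumr -big_split; apply: eq_bigr => j _ /=.
rewrite mderivM mulrDr scalerDr -scalerAl -scalerAr.
by rewrite !mulrA [p * 'X_i]mulrC.
Qed.

Lemma linear_fieldX A j : linear_field A 'X_j = \sum_i A i j *: 'X_i.
Proof.
rewrite /linear_field; apply: eq_bigr => i _.
rewrite (bigD1 j) //= mderivXU eqxx mulr1 big1 ?addr0 //.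
by move=> k kj; rewrite mderivXU eq_sym (negbTE kj) mulr0 scaler0.
Qed.

Lemma linear_fieldXn A p k :
  linear_field A (p ^+ k) = k%:R *: (p ^+ k.-1 * linear_field A p).
Proof.
elim: k => [|k IH].
  have d1 := linear_fieldM A 1 1; rewrite !mulr1 mul1r in d1.
  by rewrite expr0 scale0r; apply: (addrI (linear_field A 1)); rewrite addr0.
rewrite exprS linear_fieldM IH; case: k {IH} => [|k] /=.
  by rewrite scale0r mulr0 expr0 mulr1 mul1r addr0 scale1r.
rewrite -scalerAr mulrA -exprS [k.+2%:R]mulrS scalerDl scale1r.
by rewrite [X in X + _]mulrC.
Qed.

(** The second-order part of a composite of two linear vector fields does not
    depend on their order, because partial derivatives commute; only the
    first-order part, given by the matrix product, survives in a commutator. *)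
Lemma linear_field_comm A B p :
  linear_field (A *m B - B *m A) p
  = linear_field A (linear_field B p) - linear_field B (linear_field A p).
Proof.
pose T (A B : 'M[K]_n) : P := \sum_i \sum_j \sum_k \sum_l
  (A i j * B k l) *: ('X_i * 'X_k * p^`M(l)^`M(j)).
have DD A' B' :
    linear_field A' (linear_field B' p) = linear_field (A' *m B') p + T A' B'.
  rewrite [in LHS]/linear_field.
  rewrite [linear_field (_ *m _) p]/linear_field /T -big_split.
  apply: eq_bigr => i _ /=.
  have -> : \sum_j (A' *m B') i j *: ('X_i * p^`M(j))
      = \sum_j \sum_l (A' i j * B' j l) *: ('X_i * p^`M(l)).
    rewrite exchange_big /=; apply: eq_bigr => l _; rewrite mxE scaler_suml.
    by [].
  rewrite -big_split; apply: eq_bigr => j _ /=.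
  rewrite raddf_sum mulr_sumr scaler_sumr.
  have -> : \sum_l (A' i j * B' j l) *: ('X_i * p^`M(l)) =
      \sum_k \sum_l (A' i j * B' k l) *: ('X_i * ((k == j)%:R * p^`M(l))).
    rewrite [RHS](bigD1 j) //= [X in _ = _ + X]big1 ?addr0 => [|k /negbTE kj].
      by apply: eq_bigr => l _; rewrite eqxx mul1r.
    by apply: big1 => l _; rewrite kj mul0r mulr0 scaler0.
  rewrite -big_split; apply: eq_bigr => k _ /=.
  rewrite raddf_sum mulr_sumr scaler_sumr -big_split; apply: eq_bigr => l _ /=.
  rewrite mderivZ mderivM mderivXU -scalerAr scalerA mulrDr scalerDr.
  by rewrite -['X_i * 'X_k * _]mulrA.
have TC : T A B = T B A.
  rewrite /T.
  transitivity (\sum_i \sum_k \sum_j \sum_l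
     (A i j * B k l) *: ('X_i * 'X_k * p^`M(l)^`M(j))).
    by apply: eq_bigr => i _; rewrite exchange_big.
  rewrite exchange_big /=; apply: eq_bigr => k _.
  transitivity (\sum_i \sum_l \sum_j
     (A i j * B k l) *: ('X_i * 'X_k * p^`M(l)^`M(j))).
    by apply: eq_bigr => i _; rewrite exchange_big.
  rewrite exchange_big /=; apply: eq_bigr => l _.
  apply: eq_bigr => i _; apply: eq_bigr => j _.
  by rewrite mderiv_comm ['X_i * _]mulrC [A i j * _]mulrC.
rewrite (_ : linear_field (A *m B - B *m A) p
  = linear_field (A *m B) p - linear_field (B *m A) p); last first.
  have := linear_field_linear_mx p (-1) (B *m A) (A *m B).
  by rewrite !scaleN1r ![- _ + _]addrC.
by rewrite !DD TC opprD addrACA subrr addr0.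
Qed.

Fact linear_field_subproof A : linear_field A \in @linear_pred K P.
Proof. by apply/asboolP; exact: linear_field_linear. Qed.

Definition sl_action (A : sl K n) : endo P := Endo (linear_field_subproof A).

Lemma sl_action_linear : linear sl_action.
Proof. by move=> c A B; apply: endoP => p /=; exact: linear_field_linear_mx. Qed.

HB.instance Definition _ :=
  GRing.isLinear.Build K (sl K n) (endo P) *:%R sl_action sl_action_linear.

Lemma sl_action_lie A B :
  sl_action (lie A B) = sl_action A * sl_action B - sl_action B * sl_action A.
Proof. by apply: endoP => p; exact: linear_field_comm. Qed.

End PolynomialAction.

(** * sl_2 inside sl_3 *)

Section Embedding.
Variable K : fieldType.

(** The simple root alpha corresponds to the upper left 2 x 2 block. *)
Definition corner (A : 'M[K]_2) : 'M[K]_3 := @block_mx K 2 1 2 1 A 0 0 0.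

Lemma corner_linear : linear corner.
Proof.
move=> c A B; rewrite /corner (scale_block_mx c A 0 0 0).
by rewrite (add_block_mx (c *: A) _ _ _ B) !scaler0 !addr0.
Qed.

Lemma cornerM A B : corner (A *m B) = corner A *m corner B.
Proof.
rewrite [RHS](@mulmx_block K 2 1 2 1 2 1).
by rewrite !(mulmx0, mul0mx, addr0).
Qed.

Lemma corner_traceless (A : sl K 2) : corner A \in @traceless K 3.
Proof.
by case: A => A /=; rewrite !inE (mxtrace_block A) mxtrace0 addr0.
Qed.

Definition sl_corner (A : sl K 2) : sl K 3 := Sl (corner_traceless A).

Fact sl_corner_linear : linear sl_corner.
Proof. by move=> c A B; apply: val_inj; exact: corner_linear. Qed.

HB.instance Definition _ :=
  GRing.isLinear.Build K (sl K 2) (sl K 3) *:%R sl_corner sl_corner_linear.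

Lemma sl_corner_lie A B : sl_corner (lie A B) = lie (sl_corner A) (sl_corner B).
Proof.
apply: val_inj; rewrite /= -!cornerM.
have := corner_linear (-1) (B *m A) (A *m B).
by rewrite !scaleN1r ![- _ + _]addrC.
Qed.

Lemma sl_corner_e : sl_corner (sl2_e K) = sl3_xa K.
Proof.
apply: val_inj; apply/matrixP => i j; rewrite /= /corner !mxE.
case: splitP => k ik; rewrite mxE; case: splitP => l jl; rewrite !mxE.
all: rewrite -!(inj_eq val_inj) /= ik jl.
all: by case: k l {ik jl} => [[|[|?]] ?] [[|[|?]] ?].
Qed.

Lemma sl_corner_f : sl_corner (sl2_f K) = sl3_xma K.
Proof.
apply: val_inj; apply/matrixP => i j; rewrite /= /corner !mxE.
case: splitP => k ik; rewrite mxE; case: splitP => l jl; rewrite !mxE.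
all: rewrite -!(inj_eq val_inj) /= ik jl.
all: by case: k l {ik jl} => [[|[|?]] ?] [[|[|?]] ?].
Qed.

Lemma sl_corner_h : sl_corner (sl2_h K) = sl3_x K.
Proof. by rewrite sl_corner_lie sl_corner_e sl_corner_f. Qed.

Lemma sl2_span (A : sl K 2) :
  A = A 0 1 *: sl2_e K + (A 0 0 *: sl2_h K + A 1 0 *: sl2_f K).
Proof.
have ord2 (i : 'I_2) : i = 0 \/ i = 1.
  by case: i => [[|[|?]] ?]; [left|right|]; rewrite //; apply: val_inj.
have trA : A 1 1 = - A 0 0.
  case: A => A /=; rewrite inE /mxtrace big_ord_recl big_ord1 => /eqP trA.
  by apply/(addrI (A 0 0)); rewrite subrr -[RHS]trA; congr (_ + A _ _); apply/val_inj.
apply: val_inj; apply/matrixP => i j.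
rewrite [RHS]/= -/(sl2_h K : 'M_2) !mul_delta_mx !mxE.
by case: (ord2 i) (ord2 j) => -> [] -> /=; rewrite ?trA; ring.
Qed.

Lemma sl2_lie_he : lie (sl2_h K) (sl2_e K) = 2%:R *: sl2_e K.
Proof.
apply: val_inj; rewrite [LHS]/= !mul_delta_mx mulmxBl mulmxBr.
rewrite !(mul_delta_mx, mul_delta_mx_0) //.
by rewrite subr0 sub0r opprK /= scaler_nat.
Qed.

Lemma sl2_lie_hf : lie (sl2_h K) (sl2_f K) = - 2%:R *: sl2_f K.
Proof.
apply: val_inj; rewrite [LHS]/= !mul_delta_mx mulmxBl mulmxBr.
rewrite !(mul_delta_mx, mul_delta_mx_0) //.
by rewrite subr0 sub0r /= scaleNr scaler_nat mulr2n opprD.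
Qed.

(** The root vector of -beta, which lowers alpha + beta to alpha. *)
Definition sl3_xmb : sl K 3 := @sl_delta K 3 2%:R 1 isT.

Lemma sl3_xabE : sl3_xab K = delta_mx 0 2%:R :> 'M_3.
Proof. by rewrite /= mul_delta_mx mul_delta_mx_0 // subr0. Qed.

Lemma sl3_lie_xmb_xab : lie sl3_xmb (sl3_xab K) = - sl3_xa K.
Proof.
apply: val_inj; rewrite [LHS]/= mul_delta_mx [delta_mx 1 _ *m _]mul_delta_mx_0 //.
by rewrite subr0 mul_delta_mx_0 // mul_delta_mx sub0r.
Qed.

Lemma sl3_lie_xmb_xa : lie sl3_xmb (sl3_xa K) = 0.
Proof. by apply: val_inj; rewrite /= !mul_delta_mx_0 // subr0. Qed.

Lemma env_corner_lift :
  exists iota : {lrmorphism envalg (sl K 2) -> envalg (sl K 3)},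
    forall A, iota (env A) = env (sl_corner A).
Proof.
have f_lie A B : (@env _ _ \o sl_corner) (lie A B) =
    (@env _ _ \o sl_corner) A * (@env _ _ \o sl_corner) B
    - (@env _ _ \o sl_corner) B * (@env _ _ \o sl_corner) A.
  by rewrite /= sl_corner_lie env_lie.
exact: (env_lift f_lie).
Qed.

Section Relations.
Local Notation e := (env (sl2_e K)).
Local Notation f := (env (sl2_f K)).
Local Notation h := (env (sl2_h K)).

Lemma env_sl2_span (A : sl K 2) :
  env A = A 0 1 *: e + (A 0 0 *: h + A 1 0 *: f).
Proof.
rewrite {1}[A]sl2_span (env_linear _ (sl2_e K)) (env_linear _ (sl2_h K)).
by congr (_ + (_ + _)); exact: linearZ.
Qed.

Lemma env_ef : e * f - f * e = h.
Proof. by rewrite -env_lie. Qed.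

Lemma env_he : h * e - e * h = 2%:R *: e.
Proof. by rewrite -env_lie sl2_lie_he linearZ. Qed.

Lemma env_hf : h * f - f * h = - 2%:R *: f.
Proof. by rewrite -env_lie sl2_lie_hf linearZ. Qed.

End Relations.
End Embedding.

(** * Ordered monomials in an sl_2-triple *)

(** Ordered monomials in three elements are obtained by evaluating a polynomial
    in one of them whose coefficients have already been evaluated in the other
    two. The coefficients stay on the left because nothing commutes. *)
Section LeftEvaluation.
Variables (R : nzRingType) (B : nzRingType) (c : {additive R -> B}) (x : B).

Definition left_eval (p : {poly R}) : B := \sum_(i < size p) c p`_i * x ^+ i.

Lemma left_eval_wide m (p : {poly R}) : (size p <= m)%N ->
  left_eval p = \sum_(i < m) c p`_i * x ^+ i.
Proof.
move=> pm; rewrite /left_eval (big_ord_widen _ (fun i => c p`_i * x ^+ i) pm).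
rewrite [LHS]big_mkcond; apply: eq_bigr => i _; case: ltnP => // /leq_sizeP p0.
by rewrite p0 // raddf0 mul0r.
Qed.

Fact left_eval_additive : zmod_morphism left_eval.
Proof.
move=> p q; pose m := maxn (size (p - q)) (maxn (size p) (size q)).
rewrite !(left_eval_wide (m := m)) ?leq_max ?leqnn ?orbT // -sumrB.
by apply: eq_bigr => i _; rewrite coefB raddfB mulrBl.
Qed.

HB.instance Definition _ :=
  GRing.isZmodMorphism.Build {poly R} B left_eval left_eval_additive.

Lemma left_eval_monomial a n : left_eval (a *: 'X^n) = c a * x ^+ n.
Proof.
rewrite (left_eval_wide (m := n.+1)); last first.
  by rewrite (leq_trans (size_scale_leq _ _)) // size_polyXn.
rewrite (bigD1 ord_max) //= coefZ coefXn eqxx mulr1 big1 ?addr0 // => i.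
rewrite -val_eqE /= => /negbTE ni.
by rewrite coefZ coefXn ni mulr0 raddf0 mul0r.
Qed.

End LeftEvaluation.

Section Triples.
Variables (K : fieldType) (B : algType K).

Record sl2_triple (e h f : B) : Prop := {
  triple_ef : e * f - f * e = h;
  triple_he : h * e - e * h = 2%:R *: e;
  triple_hf : h * f - f * h = - 2%:R *: f
}.

Variables (e h f : B).

(** These polynomials in h, e and f keep h on the left, so that moving e or f
    past a coefficient p(h) only shifts the argument of p. *)
Definition eval_he : {poly {poly K}} -> B := left_eval (horner_alg h) e.
HB.instance Definition _ := GRing.Additive.on eval_he.

Definition eval_hef : {poly {poly {poly K}}} -> B := left_eval eval_he f.
HB.instance Definition _ := GRing.Additive.on eval_hef.

Lemma eval_hefE (P : {poly {poly {poly K}}}) m n : (size P <= n)%N ->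
    (forall t, (size (P`_t)%R <= m)%N) ->
  eval_hef P = \sum_(t < n) \sum_(r < m) horner_alg h P`_t`_r * e ^+ r * f ^+ t.
Proof.
move=> Pn Pm; rewrite [LHS](left_eval_wide _ _ Pn); apply: eq_bigr => t _.
by rewrite [X in X * _](left_eval_wide _ _ (Pm t)) mulr_suml.
Qed.

Definition ordered (u : B) : Prop := exists P, u = eval_hef P.

Lemma orderedD u v : ordered u -> ordered v -> ordered (u + v).
Proof. by move=> [P ->] [Q ->]; exists (P + Q); rewrite raddfD. Qed.

Lemma ordered0 : ordered 0.
Proof. by exists 0; rewrite raddf0. Qed.

Lemma ordered_monomial p r t : ordered (horner_alg h p * e ^+ r * f ^+ t).
Proof.
exists ((p *: 'X^r) *: 'X^t).
by rewrite [RHS]left_eval_monomial /= [eval_he _]left_eval_monomial.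
Qed.

Lemma ordered_mull b :
    (forall p r t, ordered (b * (horner_alg h p * e ^+ r * f ^+ t))) ->
  forall u, ordered u -> ordered (b * u).
Proof.
move=> Hb _ [P ->].
have Pm t : (size (P`_t)%R <= \max_(i < size P) size (P`_i)%R)%N.
  case: (ltnP t (size P)) => tP.
    exact: (leq_bigmax (Ordinal tP)).
  by rewrite nth_default // size_poly0.
rewrite (eval_hefE (leqnn _) Pm) mulr_sumr.
elim/big_ind: _ => [||t _]; [exact: ordered0 | exact: orderedD |].
rewrite mulr_sumr; elim/big_ind: _ => [||r _]; last exact: Hb.
  exact: ordered0.
exact: orderedD.
Qed.

Hypothesis T : sl2_triple e h f.

Lemma ordered_h u : ordered u -> ordered (h * u).
Proof.
apply: ordered_mull => p r t.
have -> : h * (horner_alg h p * e ^+ r * f ^+ t)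
    = horner_alg h ('X * p) * e ^+ r * f ^+ t.
  by rewrite rmorphM /= horner_algX !mulrA.
exact: ordered_monomial.
Qed.

Lemma ordered_scale c u : ordered u -> ordered (c *: u).
Proof.
rewrite -[c *: u]mulr_algl; apply: ordered_mull => p r t.
have -> : c%:A * (horner_alg h p * e ^+ r * f ^+ t)
    = horner_alg h (c%:P * p) * e ^+ r * f ^+ t.
  by rewrite rmorphM /= horner_algC !mulrA.
exact: ordered_monomial.
Qed.

(** Moving a polynomial in h through x, where [h, x] = c x, shifts its
    argument by c. *)
Lemma shift_horner_alg (c : K) (x : B) p : h * x - x * h = c *: x ->
  x * horner_alg h p = horner_alg h (p \Po ('X - c%:P)) * x.
Proof.
move=> hx; have xh : x * h = (h - c%:A) * x.
  by rewrite mulrBl mulr_algl -hx opprB addrC subrK.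
elim/poly_ind: p => [|p a IH]; first by rewrite comp_poly0 !raddf0 mulr0 mul0r.
rewrite comp_poly_MXaddC !rmorphD !rmorphM /= rmorphB /=.
rewrite !horner_algC !horner_algX mulrDr mulrDl mulrA IH -!mulrA xh.
by rewrite mulr_algr mulr_algl.
Qed.

Lemma ordered_e u : ordered u -> ordered (e * u).
Proof.
apply: ordered_mull => p r t.
rewrite !mulrA (shift_horner_alg _ (triple_he T)).
by rewrite -[_ * e * _]mulrA -exprS; exact: ordered_monomial.
Qed.

(** The classical commutation of f with a power of e, which lowers the power by
    one at the cost of a factor that is linear in h. *)
Lemma triple_f_expe r :
  f * e ^+ r.+1
  = e ^+ r.+1 * f - horner_alg h (r.+1%:R *: ('X - r%:R%:P)) * e ^+ r.
Proof.
have fe : f * e = e * f - h by rewrite -(triple_ef T) opprB addrC subrK.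
elim: r => [|r IH].
  by rewrite subr0 scale1r horner_algX expr0 mulr1 expr1.
have -> : f * e ^+ r.+2 = e * (f * e ^+ r.+1) - h * e ^+ r.+1.
  by rewrite (exprS e r.+1) mulrA fe mulrBl mulrA.
rewrite IH mulrBr !mulrA -exprS.
rewrite (shift_horner_alg _ (triple_he T)) -[_ * e * _]mulrA -exprS.
rewrite -addrA -opprD -mulrDl -{2}(horner_algX h) -rmorphD.
congr (_ - horner_alg h _ * _).
rewrite comp_polyZ comp_polyB comp_polyX comp_polyC -!mul_polyC !rmorph_nat.
by rewrite -!natr1; ring.
Qed.

Lemma ordered_f u : ordered u -> ordered (f * u).
Proof.
apply: ordered_mull => p r t.
have -> : f * (horner_alg h p * e ^+ r * f ^+ t)
    = horner_alg h (p \Po ('X - (- 2%:R)%:P)) * (f * e ^+ r) * f ^+ t.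
  by rewrite !mulrA (shift_horner_alg _ (triple_hf T)).
case: r => [|r].
  rewrite expr0 mulr1 -mulrA -exprS -[X in X * _]mulr1.
  exact: (ordered_monomial _ 0).
rewrite triple_f_expe mulrBr mulrBl mulrA -mulrA -exprS mulrA -rmorphM.
apply: orderedD; first exact: ordered_monomial.
by rewrite -scaleN1r; apply: ordered_scale; exact: ordered_monomial.
Qed.

Lemma ordered_triple a b c u :
  ordered u -> ordered ((a *: e + (b *: h + c *: f)) * u).
Proof.
move=> Nu; rewrite !mulrDl -!scalerAl.
apply: orderedD; first by apply: ordered_scale; exact: ordered_e.
apply: orderedD; first by apply: ordered_scale; exact: ordered_h.
by apply: ordered_scale; exact: ordered_f.
Qed.

End Triples.

Lemma eval_hef_morph (K : fieldType) (B C : algType K) (F : {lrmorphism B -> C})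
    (e h f : B) P :
  F (eval_hef e h f P) = eval_hef (F e) (F h) (F f) P.
Proof.
have Fh p : F (horner_alg h p) = horner_alg (F h) p.
  elim/poly_ind: p => [|p c IH]; first by rewrite !raddf0.
  by rewrite !rmorphD !rmorphM /= IH !horner_algX !horner_algC rmorph_alg.
rewrite rmorph_sum; apply: eq_bigr => t _; rewrite rmorphM rmorphXn /=.
congr (_ * _); rewrite rmorph_sum; apply: eq_bigr => r _.
by rewrite rmorphM rmorphXn /= Fh.
Qed.

Lemma sl2_triple_morph (K : fieldType) (B C : algType K) (F : {lrmorphism B -> C})
    (e h f : B) :
  sl2_triple e h f -> sl2_triple (F e) (F h) (F f).
Proof.
case=> ef he hf; split; rewrite -!rmorphM -rmorphB.
- by rewrite ef.
- by rewrite he; exact: linearZ.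
- by rewrite hf; exact: linearZ.
Qed.

Lemma env_sl2_triple (K : fieldType) :
  sl2_triple (env (sl2_e K)) (env (sl2_h K)) (env (sl2_f K)).
Proof. by split; [exact: env_ef | exact: env_he | exact: env_hf]. Qed.

(** The spanning half of the Poincare-Birkhoff-Witt theorem for sl_2: the span
    of the ordered monomials contains 1 and is stable under left multiplication
    by e, h and f. *)
Lemma env_sl2_ordered (K : fieldType) (u : envalg (sl K 2)) :
  exists P, u = eval_hef (env (sl2_e K)) (env (sl2_h K)) (env (sl2_f K)) P.
Proof.
have T := env_sl2_triple K.
elim/env_ind: u => [|c u v Nu Nv|A u Nu].
- have := ordered_monomial (env (sl2_e K)) (env (sl2_h K)) (env (sl2_f K)) 1 0 0.
  by rewrite !expr0 !mulr1 rmorph1.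
- by apply: orderedD Nv; exact: ordered_scale.
rewrite (env_sl2_span A); exact: ordered_triple.
Qed.

(** * Faithfulness of the action of sl_2 on binary forms *)

Lemma endo_horner (K : fieldType) (V : lalgType K) (H : endo V) c v p :
  endo_val H v = c *: v -> endo_val (horner_alg H p) v = p.[c] *: v.
Proof.
move=> Hv; elim/poly_ind: p => [|p a IH]; first by rewrite raddf0 horner0 scale0r.
rewrite rmorphD rmorphM /= horner_algX horner_algC hornerMXaddC.
rewrite -[LHS]/(endo_val (horner_alg H p) (endo_val H v) + a *: v).
by rewrite Hv linearZ /= IH scalerA scalerDl [c * _]mulrC.
Qed.

Section BinaryForms.
Variable K : numFieldType.
Local Notation P := (mpoly 3 K).

Lemma linear_field_delta n (k l j : 'I_n) :
  linear_field (delta_mx k l) 'X_j = (j == l)%:R *: 'X_k :> mpoly n K.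
Proof.
rewrite linear_fieldX (bigD1 k) //= mxE eqxx /= big1 ?addr0 // => i ik.
by rewrite mxE (negbTE ik) scale0r.
Qed.

Definition binary_monomial (a b : nat) : P := 'X_0 ^+ a * 'X_1 ^+ b.
Local Notation M := binary_monomial.

Local Notation E := (sl_action (sl3_xa K)).
Local Notation F := (sl_action (sl3_xma K)).
Local Notation H := (sl_action (sl3_x K)).

Lemma action_e a b : endo_val E (M a b) = b%:R *: M a.+1 b.-1.
Proof.
rewrite /= linear_fieldM !linear_fieldXn !linear_field_delta /=.
rewrite scale0r mulr0 scaler0 mul0r add0r scale1r -scalerAr /M.
by rewrite ['X_1 ^+ _ * _]mulrC mulrA -exprSr.
Qed.

Lemma action_f a b : endo_val F (M a b) = a%:R *: M a.-1 b.+1.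
Proof.
rewrite /= linear_fieldM !linear_fieldXn !linear_field_delta /=.
rewrite scale0r mulr0 scaler0 mulr0 addr0 scale1r -scalerAl /M.
by rewrite -mulrA -exprS.
Qed.

Lemma action_h a b : endo_val H (M a b) = (a%:R - b%:R) *: M a b.
Proof.
rewrite sl_action_lie -[LHS]/(endo_val E (endo_val F (M a b))
  - endo_val F (endo_val E (M a b))).
rewrite action_f action_e !endo_scale !action_e !action_f !scalerA.
(* At a = 0 or b = 0 the truncated exponents are wrong, but then the scalar in
   front of them vanishes. *)
have -> : (a%:R * b.+1%:R) *: M a.-1.+1 b.+1.-1 = (a%:R * b.+1%:R) *: M a b.
  by case: a => [|a]; rewrite ?mul0r ?scale0r.
have -> : (b%:R * a.+1%:R) *: M a.+1.-1 b.-1.+1 = (b%:R * a.+1%:R) *: M a b.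
  by case: b => [|b]; rewrite ?mul0r ?scale0r.
by rewrite -scalerBl; congr (_ *: _); rewrite -!natr1; ring.
Qed.

Lemma action_expe r a b :
  endo_val (E ^+ r) (M a b) = (b ^_ r)%:R *: M (a + r) (b - r).
Proof.
elim: r => [|r IH]; first by rewrite expr0 endo1E ffactn0 scale1r addn0 subn0.
rewrite exprS endoME IH endo_scale action_e scalerA -natrM -ffactnSr.
by rewrite addnS subnS.
Qed.

Lemma action_expf t a b :
  endo_val (F ^+ t) (M a b) = (a ^_ t)%:R *: M (a - t) (b + t).
Proof.
elim: t => [|t IH]; first by rewrite expr0 endo1E ffactn0 scale1r addn0 subn0.
rewrite exprS endoME IH endo_scale action_f scalerA -natrM -ffactnSr.
by rewrite addnS subnS.
Qed.

Lemma action_ordered p r t a b :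
  endo_val (horner_alg H p * E ^+ r * F ^+ t) (M a b)
  = ((a ^_ t)%:R * ((b + t) ^_ r)%:R * p.[(a - t + r)%:R - (b + t - r)%:R])
    *: M (a - t + r) (b + t - r).
Proof.
rewrite !endoME action_expf endo_scale action_expe endo_scale endo_scale.
by rewrite (endo_horner _ (action_h _ _)) !scalerA.
Qed.

Lemma mcoeff_binary_monomial a b c d :
  (M a b)@_(U_(0%R) *+ c + U_(1%R) *+ d)%MM = ((a == c) && (b == d))%:R.
Proof.
rewrite /M !mpolyXn -mpolyXD mcoeffX; congr (_%:R : K); congr nat_of_bool.
apply/eqP/andP => [eq_m|[/eqP -> /eqP ->] //].
have := congr1 (fun m : 'X_{1..3} => (m 0, m 1)) eq_m.
by rewrite !mnmDE !mulmnE !mnm1E /= !mul1n !mul0n !addn0 !add0n => -[-> ->].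
Qed.

(** A nonzero polynomial has finitely many roots. *)
Lemma poly_eventually_zero (p : {poly K}) (c : K) N :
  (forall b, (N <= b)%N -> p.[c - b%:R] = 0) -> p = 0.
Proof.
move=> p0; apply/eqP; case: eqVneq => // p_neq0.
pose s := [seq c - b%:R | b <- iota N (size p)].
have /(max_poly_roots p_neq0) : all (root p) s.
  by apply/allP => x /mapP[b]; rewrite mem_iota => /andP[Nb _] ->; apply/rootP/p0.
rewrite map_inj_uniq ?iota_uniq => [/(_ isT)|b b' /addrI/oppr_inj/eqP].
  by rewrite size_map size_iota ltnn.
by rewrite eqr_nat => /eqP.
Qed.

(** If t is the least exponent of f in Q, then f ^ t' kills X^t Y^b for t' > t,
    so that only the terms in f ^ t act on it. They send it to multiples of
    distinct monomials, by factors that are values of the coefficients at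
    infinitely many points as b varies. *)
Lemma eval_action_inj Q : eval_hef E H F Q = 0 -> Q = 0.
Proof.
move=> Q0.
pose m := (\max_(i < size Q) size (Q`_i)%R)%N.
have Qm t : (size (Q`_t)%R <= m)%N.
  case: (ltnP t (size Q)) => tQ.
    exact: (leq_bigmax (F := fun i : 'I_(size Q) => size (Q`_i)%R) (Ordinal tQ)).
  by rewrite nth_default // size_poly0.
rewrite (eval_hefE _ _ _ (leqnn _) Qm) in Q0.
suff Qt t : Q`_t = 0 by apply/polyP => t; rewrite Qt coef0.
elim/ltn_ind: t => t IH; case: (ltnP t (size Q)) => [tQ|]; last first.
  by move=> Qlet; rewrite nth_default.
apply/polyP => r; rewrite coef0; case: (ltnP r m) => [rm|mr]; last first.
  by rewrite nth_default // (leq_trans (Qm t)).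
(* Here b is the total degree: e^r f^t maps X^t Y^(b-t) to a multiple of
   X^r Y^(b-r), whose weight is (r + r) - b. As b >= m > r, no exponent is
   truncated. *)
apply: (@poly_eventually_zero _ (r + r)%:R (maxn m t)) => b.
rewrite geq_max => /andP[mb tb].
have rb : (r <= b)%N by exact: leq_trans (ltnW rm) mb.
pose G (g : endo P) :=
  (endo_val g (M t (b - t)))@_(U_(0%R) *+ r + U_(1%R) *+ (b - r))%MM.
have GD : {morph G : x y / x + y} by move=> x y; rewrite /G endoDE mcoeffD.
have G0 : G 0 = 0 by exact: mcoeff0.
have GE p r' t' : G (horner_alg H p * E ^+ r' * F ^+ t')
    = (t ^_ t')%:R * ((b - t + t') ^_ r')%:R
      * p.[(t - t' + r')%:R - (b - t + t' - r')%:R]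
      * ((t - t' + r' == r) && (b - t + t' - r' == b - r))%N%:R.
  by rewrite /G action_ordered mcoeffZ mcoeff_binary_monomial.
have := congr1 G Q0; rewrite (big_morph G GD G0) G0.
rewrite (bigD1 (Ordinal tQ)) //= [X in _ + X]big1 ?addr0 => [|t' tt']; last first.
  rewrite (big_morph G GD G0) big1 // => r' _; rewrite GE.
  move: tt'; rewrite -val_eqE neq_ltn /= => /orP[tgt|tlt]; last first.
    by rewrite ffact_small // !mul0r.
  by rewrite IH // coef0 horner0 mulr0 mul0r.
rewrite (big_morph G GD G0) (bigD1 (Ordinal rm)) //= [X in _ + X]big1 ?addr0.
  rewrite GE subnn subnK // eqxx /= add0n eqxx mulr1 natrB // => /eqP.
  rewrite !mulf_eq0 !pnatr_eq0 !eqn0Ngt !ffact_gt0 leqnn rb /=.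
  by move=> /eqP; rewrite natrD opprB addrA.
move=> r' rr'; rewrite GE subnn add0n; move: rr'; rewrite -val_eqE /= => /negbTE ->.
by rewrite mulr0.
Qed.

End BinaryForms.

(** * The homomorphism of enveloping algebras is injective *)

(** An element of the kernel acts as 0 on binary forms, through the action of
    sl_3 on ternary forms; so it has zero coefficients on ordered monomials. *)
Lemma env_corner_inj (K : numFieldType)
    (iota : {lrmorphism envalg (sl K 2) -> envalg (sl K 3)}) :
  (forall A, iota (env A) = env (sl_corner A)) -> injective iota.
Proof.
move=> iotaE; have [rho rhoE] := env_lift (@sl_action_lie K 3).
suff ker u : iota u = 0 -> u = 0 by apply: raddf_inj; exact: ker.
have [Q ->] := env_sl2_ordered u => iota0.
have := congr1 rho iota0; rewrite eval_hef_morph eval_hef_morph.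
rewrite !iotaE !rhoE sl_corner_e sl_corner_h sl_corner_f.
by rewrite [rho 0]raddf0 => /eval_action_inj ->; rewrite raddf0.
Qed.

(** * The quotient by the square of a root vector *)

Section SquareIdeal.
Variables (K : numFieldType) (A : algType K) (S : set A).

(** Bracketing with x is a derivation that preserves the ideal; applied twice
    to y ^ 2, where [x, y] = - a and [x, a] = 0, it gives 2 a ^ 2. *)
Lemma ideal_sqr_lower (x y a : A) :
    x * y - y * x = - a -> x * a = a * x ->
  ideal S (y ^+ 2) -> ideal S (a ^+ 2).
Proof.
move=> xy xa Sy.
have SB u v : ideal S u -> ideal S v -> ideal S (u - v).
  by move=> Su Sv; rewrite -scaleN1r; apply: spanD => //; exact: spanZ.
have Sz : ideal S (a * y + y * a).
  have -> : a * y + y * a = y ^+ 2 * x - x * y ^+ 2.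
    have -> : a = y * x - x * y by rewrite -[LHS]opprK -xy opprB.
    by rewrite mulrBl mulrBr expr2 !mulrA addrC addrA subrK.
  by apply: SB; [exact: ideal_mulr | exact: ideal_mull].
have -> : a ^+ 2 = 2%:R^-1 *: ((a * y + y * a) * x - x * (a * y + y * a)).
  have -> : (a * y + y * a) * x - x * (a * y + y * a)
      = a * (y * x - x * y) + (y * x - x * y) * a.
    rewrite mulrDl mulrDr mulrBr mulrBl !mulrA xa opprD addrACA.
    by rewrite -[y * a * x]mulrA -xa mulrA.
  have -> : y * x - x * y = a by rewrite -[RHS]opprK -xy opprB.
  by rewrite -expr2 -mulr2n -scaler_nat scalerA mulVf ?scale1r // pnatr_eq0.
by apply/spanZ/SB; [exact: ideal_mulr | exact: ideal_mull].
Qed.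

End SquareIdeal.

(** Bracketing the relation e^2 = 0 repeatedly with f gives in turn
    he + eh = 0, h^2 = 2 fe + h and hf + fh = 0, hence f^2 = 0. These reduce
    every product to a combination of 1, e, f, h, h^2. *)
Section SquareZero.
Variables (K : numFieldType) (B : algType K) (e h f : B).
Hypotheses (T : sl2_triple e h f) (e0 : e * e = 0).

Lemma nat_scaler_eq0 n (u : B) : n.+1%:R *: u = 0 -> u = 0.
Proof. by move/eqP; rewrite scaler_eq0 pnatr_eq0 => /eqP. Qed.

Lemma sqr0_efE : e * f = f * e + h.
Proof. by rewrite -(triple_ef T) addrC subrK. Qed.

Lemma sqr0_fhE : f * h = h * f + 2%:R *: f.
Proof.
by rewrite -[2%:R *: f]opprK -scaleNr -(triple_hf T) opprB addrC subrK.
Qed.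

Lemma sqr0_he : h * e = e.
Proof.
have he : h * e + e * h = 0.
  have := congr1 (fun u => u * f) e0; rewrite /= mul0r -mulrA sqr0_efE mulrDr mulrA.
  by rewrite sqr0_efE mulrDl -mulrA e0 mulr0 add0r.
apply/subr0_eq/(@nat_scaler_eq0 1); rewrite scalerBr -(triple_he T) opprB.
by rewrite scaler_nat mulr2n [e * h - _]addrC addrA addrK.
Qed.

Lemma sqr0_eh : e * h = - e.
Proof.
have -> : e * h = h * e - 2%:R *: e by rewrite -(triple_he T) opprB addrC subrK.
by rewrite sqr0_he scaler_nat mulr2n opprD addrA subrr sub0r.
Qed.

Lemma sqr0_hh : h * h = 2%:R *: (f * e) + h.
Proof.
have hfe : h * (f * e) = f * e + (h - h * h).
  have -> : f * e = e * f - h by rewrite sqr0_efE addrK.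
  by rewrite mulrBr mulrA sqr0_he addrA subrK.
have := mulrA f h e; rewrite sqr0_he sqr0_fhE mulrDl -mulrA hfe -scalerAl.
rewrite -[LHS]addr0 -!addrA => /addrI E.
by apply/eqP; rewrite eq_sym -subr_eq0 -addrA addrC -addrA -E.
Qed.

Lemma sqr0_hf : h * f = - f.
Proof.
(* Both sides of h^2 = 2 f e + h are commuted with f; comparing the results
   gives 6 (h f + f) = 0. *)
have comm1 : f * (h * h) = h * h * f + 4%:R *: (h * f + f).
  rewrite mulrA sqr0_fhE mulrDl -[h * f * h]mulrA -scalerAl sqr0_fhE.
  rewrite mulrDr mulrA -scalerAr -!addrA; congr (_ + _).
  rewrite !scalerDr scalerA -natrM addrA -scalerDl -natrD.
  by [].
have comm2 : f * (h * h) = h * h * f - 2%:R *: (h * f + f).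
  rewrite !sqr0_hh mulrDl mulrDr -scalerAl -scalerAr -mulrA sqr0_efE.
  rewrite [f * (f * e + h)]mulrDr scalerDr sqr0_fhE -!addrA; congr (_ + _).
  rewrite [h * f - _]addrC addrA -scalerBr opprD addrACA subrr add0r.
  have -> : 2%:R *: f - f = f by rewrite scaler_nat mulr2n addrK.
  exact: addrC.
have : 4%:R *: (h * f + f) = - 2%:R *: (h * f + f).
  by apply: (addrI (h * h * f)); rewrite -comm1 comm2 scaleNr.
move/eqP; rewrite -subr_eq0 -scalerBl opprK -natrD => /eqP.
by move/(@nat_scaler_eq0 5)/eqP; rewrite addr_eq0 => /eqP.
Qed.

Lemma sqr0_fh : f * h = f.
Proof. by rewrite sqr0_fhE sqr0_hf scaler_nat mulr2n addrA addNr add0r. Qed.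

Lemma sqr0_ff : f * f = 0.
Proof.
apply: (@nat_scaler_eq0 1); rewrite scaler_nat mulr2n -{1}sqr0_fh -mulrA sqr0_hf.
by rewrite mulrN addNr.
Qed.

Lemma sqr0_fe : f * e = 2%:R^-1 *: (h * h) + - 2%:R^-1 *: h.
Proof.
by rewrite scaleNr -scalerBr sqr0_hh addrK scalerA mulVf ?scale1r // pnatr_eq0.
Qed.

Lemma sqr0_ef : e * f = 2%:R^-1 *: (h * h) + 2%:R^-1 *: h.
Proof.
rewrite sqr0_efE sqr0_fe -addrA; congr (_ + _).
rewrite -[X in _ + X]scale1r -scalerDl; congr (_ *: _).
by field.
Qed.

Definition sqr0_basis := [:: 1; e; f; h; h * h].

Definition sqr0_comb (c : nat -> K) : B := \sum_(i < 5) c i *: sqr0_basis`_i.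

Definition sqr0_spanned (u : B) : Prop := exists c, u = sqr0_comb c.

Lemma sqr0_spannedZD a u v :
  sqr0_spanned u -> sqr0_spanned v -> sqr0_spanned (a *: u + v).
Proof.
move=> [c ->] [d ->]; exists (fun i => a * c i + d i).
rewrite /sqr0_comb scaler_sumr -big_split; apply: eq_bigr => i _ /=.
by rewrite scalerDl scalerA.
Qed.

Lemma sqr0_spanned0 : sqr0_spanned 0.
Proof. by exists (fun=> 0); rewrite /sqr0_comb big1 // => i _; rewrite scale0r. Qed.

Lemma sqr0_spannedZ a u : sqr0_spanned u -> sqr0_spanned (a *: u).
Proof. by move=> Su; rewrite -[_ *: _]addr0; apply: sqr0_spannedZD sqr0_spanned0. Qed.

Lemma sqr0_spannedD u v : sqr0_spanned u -> sqr0_spanned v -> sqr0_spanned (u + v).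
Proof. by move=> Su Sv; rewrite -[u]scale1r; exact: sqr0_spannedZD. Qed.

Lemma sqr0_spannedN u : sqr0_spanned u -> sqr0_spanned (- u).
Proof. by rewrite -scaleN1r; exact: sqr0_spannedZ. Qed.

Lemma sqr0_spanned_basis i : sqr0_spanned sqr0_basis`_i.
Proof.
case: (ltnP i 5) => i5; last by rewrite nth_default //; exact: sqr0_spanned0.
exists (fun j => (j == i)%:R); rewrite /sqr0_comb (bigD1 (Ordinal i5)) //=.
rewrite eqxx scale1r big1 ?addr0 // => j.
by rewrite -val_eqE /= => /negbTE ->; rewrite scale0r.
Qed.

Lemma sqr0_spanned_mul a b c u : sqr0_spanned u ->
  sqr0_spanned ((a *: e + (b *: h + c *: f)) * u).
Proof.
have s1 := sqr0_spanned_basis 0; have se := sqr0_spanned_basis 1.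
have sf := sqr0_spanned_basis 2; have sh := sqr0_spanned_basis 3.
have shh := sqr0_spanned_basis 4.
have sZD k l x y : sqr0_spanned x -> sqr0_spanned y ->
    sqr0_spanned (k *: x + l *: y).
  by move=> Sx Sy; apply: sqr0_spannedZD => //; exact: sqr0_spannedZ.
move=> [d ->]; rewrite mulr_sumr.
elim/big_ind: _ => [||i _]; [exact: sqr0_spanned0 | exact: sqr0_spannedD |].
rewrite -scalerAr; apply: sqr0_spannedZ; rewrite !mulrDl -!scalerAl.
apply: sqr0_spannedZD; last apply: (sZD).
- case: i => [[|[|[|[|[|//]]]]] ?] /=.
  + by rewrite mulr1.
  + by rewrite e0; exact: sqr0_spanned0.
  + by rewrite sqr0_ef; exact: sZD.
  + by rewrite sqr0_eh; exact: sqr0_spannedN.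
  + by rewrite mulrA sqr0_eh mulNr sqr0_eh opprK.
- case: i => [[|[|[|[|[|//]]]]] ?] /=.
  + by rewrite mulr1.
  + by rewrite sqr0_he.
  + by rewrite sqr0_hf; exact: sqr0_spannedN.
  + by [].
  + rewrite sqr0_hh mulrDr -scalerAr mulrA sqr0_hf mulNr sqr0_fe.
    apply: sqr0_spannedZD; last exact: shh.
    by apply: sqr0_spannedN; exact: sZD.
- case: i => [[|[|[|[|[|//]]]]] ?] /=.
  + by rewrite mulr1.
  + by rewrite sqr0_fe; exact: sZD.
  + by rewrite sqr0_ff; exact: sqr0_spanned0.
  + by rewrite sqr0_fh.
  + by rewrite mulrA sqr0_fh sqr0_fh.
Qed.

(** The images of 1, e, f, h, h^2 are independent because the third diagonal
    entry detects 1, while e and f are off-diagonal and h, h^2 are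
    diag(1, -1, 0) and diag(1, 1, 0). *)
Lemma sqr0_spanned_inj (F : {lrmorphism B -> 'M[K]_3}) u :
    F e = delta_mx 0 1 -> F f = delta_mx 1 0 ->
    F h = delta_mx 0 0 - delta_mx 1 1 ->
  sqr0_spanned u -> F u = 0 -> u = 0.
Proof.
move=> Fe Ff Fh [c ->] /matrixP F0.
have FE i j : (c 0 *: (1 : 'M[K]_3) + c 1 *: F e + c 2 *: F f + c 3 *: F h
    + c 4 *: (F h * F h)) i j = 0.
  have := F0 i j; rewrite mxE => <-; rewrite /sqr0_comb.
  rewrite !big_ord_recr big_ord0 /= add0r !raddfD /= !linearZ /=.
  by rewrite rmorph1 rmorphM.
have FhFh : F h * F h = delta_mx 0 0 + delta_mx 1 1.
  rewrite Fh -[LHS]/(_ *m _) mulmxBl !mulmxBr !(mul_delta_mx, mul_delta_mx_0) //.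
  by rewrite subr0 sub0r opprK.
rewrite {}FhFh {}Fe {}Ff {}Fh in FE.
have c0 : c 0 = 0.
  by have := FE 2%:R 2%:R; rewrite !mxE /= !(mulr0, mulr1, subrr, addr0) => ->.
have c1 : c 1%N = 0.
  by have := FE 0 1; rewrite !mxE /= !(mulr0, mulr1, subrr, addr0, add0r) => ->.
have c2 : c 2%N = 0.
  by have := FE 1 0; rewrite !mxE /= !(mulr0, mulr1, subrr, addr0, add0r) => ->.
have c34 : c 3%N + c 4%N = 0.
  have := FE 0 0; rewrite !mxE /= c0.
  by rewrite !(mulr0, mulr1, mul0r, subr0, addr0, add0r) => ->.
have c43 : - c 3%N + c 4%N = 0.
  have := FE 1 1; rewrite !mxE /= c0.
  by rewrite !(mulr0, mulr1, mul0r, sub0r, addr0, add0r, mulrN1) => ->.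
have c4 : c 4%N = 0.
  move: c43; rewrite (canRL (addrK _) c34) sub0r opprK -mulr2n => /eqP.
  by rewrite mulrn_eq0 => /eqP.
have c3 : c 3%N = 0 by move: c34; rewrite c4 addr0.
rewrite /sqr0_comb !big_ord_recr big_ord0 /=.
by rewrite c0 c1 c2 c3 c4 !scale0r !addr0.
Qed.

End SquareZero.

Section Quotients.
Variable K : numFieldType.
Local Notation Q2 := (aquot (sqr_gens (sl2_e K))).
Local Notation Q3 := (aquot (sqr_gens (sl3_xab K))).
Local Notation cl2 := (aclass (sqr_gens (sl2_e K))).
Local Notation cl3 := (aclass (sqr_gens (sl3_xab K))).

Lemma sqr_xa_ideal : ideal [set env (sl3_xab K) ^+ 2] (env (sl3_xa K) ^+ 2).
Proof.
apply: (@ideal_sqr_lower _ _ _ (env (sl3_xmb K)) (env (sl3_xab K))).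
- by rewrite -env_lie sl3_lie_xmb_xab; exact: linearN.
- by apply: subr0_eq; rewrite -env_lie sl3_lie_xmb_xa; exact: linear0.
- exact: ideal_gen.
Qed.

Lemma aquot_corner_lift (iota : {lrmorphism envalg (sl K 2) -> envalg (sl K 3)}) :
    (forall A, iota (env A) = env (sl_corner A)) ->
  exists pi : {lrmorphism Q2 -> Q3}, forall u, pi (cl2 u) = cl3 (iota u).
Proof.
move=> iotaE.
have killed s : gens (sqr_gens (sl2_e K)) s -> (cl3 \o iota) s = 0.
  have iota_sqr u : iota (u ^+ 2) = iota u ^+ 2 by exact: rmorphXn.
  move=> ->; rewrite /= iota_sqr iotaE sl_corner_e -[RHS](raddf0 cl3).
  by apply/(aclassP (sqr_gens (sl3_xab K))); rewrite subr0; exact: sqr_xa_ideal.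
exact: (aquot_lift killed).
Qed.

(** The natural representation of sl_3 on K^3 annihilates x_(alpha+beta)^2. *)
Lemma natural_rep :
  exists F : {lrmorphism Q3 -> 'M[K]_3}, forall A, F (cl3 (env A)) = sl_val A.
Proof.
have val_lie (A B : sl K 3) :
    sl_val (lie A B) = (sl_val A : 'M[K]_3) * sl_val B
                       - (sl_val B : 'M[K]_3) * sl_val A by [].
have sl_val_linear : linear (@sl_val K 3) by [].
pose vL := GRing.isLinear.Build _ _ _ _ (@sl_val K 3) sl_val_linear.
pose v : {linear sl K 3 -> 'M[K]_3} := HB.pack (@sl_val K 3) vL.
have [rho rhoE] := @env_lift _ _ _ v val_lie.
have killed s : gens (sqr_gens (sl3_xab K)) s -> rho s = 0.
  have rho_sqr u : rho (u ^+ 2) = rho u ^+ 2 by exact: rmorphXn.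
  move=> ->; rewrite rho_sqr rhoE -[v _]/(sl_val _ : 'M[K]_3) sl3_xabE expr2.
  by rewrite -[LHS]/(_ *m _) mul_delta_mx_0.
have [F FE] := aquot_lift killed.
by exists F => A; rewrite FE rhoE.
Qed.

Lemma aquot_sl2_spanned u :
  sqr0_spanned (cl2 (env (sl2_e K))) (cl2 (env (sl2_h K))) (cl2 (env (sl2_f K)))
    (cl2 u).
Proof.
have T : sl2_triple (cl2 (env (sl2_e K))) (cl2 (env (sl2_h K))) (cl2 (env (sl2_f K))).
  exact: sl2_triple_morph (env_sl2_triple K).
have e0 : cl2 (env (sl2_e K)) * cl2 (env (sl2_e K)) = 0.
  rewrite -[RHS](raddf0 cl2); apply: etrans (esym (rmorphM cl2 _ _)) _.
  by apply/(aclassP (sqr_gens (sl2_e K))); rewrite subr0; exact: ideal_gen.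
elim/env_ind: u => [|c u v Su Sv|A u Su].
- exact: (sqr0_spanned_basis _ _ _ 0).
- by rewrite (linearP cl2); exact: sqr0_spannedZD.
have -> : cl2 (env A * u) = cl2 (env A) * cl2 u by exact: rmorphM.
have -> : cl2 (env A) = A 0 1 *: cl2 (env (sl2_e K))
    + (A 0 0 *: cl2 (env (sl2_h K)) + A 1 0 *: cl2 (env (sl2_f K))).
  have clP c x y : cl2 (c *: x + y) = c *: cl2 x + cl2 y by exact: linearP.
  have clZ c x : cl2 (c *: x) = c *: cl2 x by exact: linearZ.
  rewrite (env_sl2_span A); apply: etrans (clP _ (env (sl2_e K)) _) _.
  apply: (congr1 (fun v => A 0 1 *: cl2 (env (sl2_e K)) + v)).
  apply: etrans (clP _ (env (sl2_h K)) _) _.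
  apply: (congr1 (fun v => A 0 0 *: cl2 (env (sl2_h K)) + v)).
  exact: (clZ _ (env (sl2_f K))).
exact: sqr0_spanned_mul.
Qed.

(** The composite of pi with the natural representation of sl_3 is already
    injective. *)
Lemma aquot_corner_inj (iota : {lrmorphism envalg (sl K 2) -> envalg (sl K 3)})
    (pi : {lrmorphism Q2 -> Q3}) :
    (forall A, iota (env A) = env (sl_corner A)) ->
  (forall u, pi (cl2 u) = cl3 (iota u)) -> injective pi.
Proof.
move=> iotaE piE; have [F FE] := natural_rep.
suff ker u : pi u = 0 -> u = 0 by apply: raddf_inj; exact: ker.
move=> piu0.
have G A : F (pi (cl2 (env A))) = sl_val (sl_corner A) by rewrite piE iotaE FE.
rewrite -[u]aclass_repr in piu0 *.
apply: (sqr0_spanned_inj (F := F \o pi) _ _ _ (aquot_sl2_spanned _)).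
- by apply: etrans (G _) _; rewrite sl_corner_e.
- by apply: etrans (G _) _; rewrite sl_corner_f.
- by apply: etrans (G _) _; rewrite sl_corner_h /= !mul_delta_mx.
- by rewrite /= piu0; exact: raddf0.
Qed.

End Quotients.

(** * Vertex algebra maps commuting with the grading operator *)

Section Modes.
Variables (K : numFieldType) (V : vertexAlgType K).

HB.instance Definition _ (a : V) (n : int) :=
  GRing.isLinear.Build K V V *:%R (vmode a n) (@vmode_linear_r K V a n).

Lemma vmodeDl (n : int) (b a a' : V) :
  vmode (a + a') n b = vmode a n b + vmode a' n b.
Proof. by have := vmode_linear_l n b 1 a a'; rewrite !scale1r. Qed.

Lemma vmode0l (n : int) (b : V) : vmode 0 n b = 0.
Proof. by apply: (addrI (vmode 0 n b)); rewrite -vmodeDl !addr0. Qed.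

Lemma fsum_nat_bounded (M : zmodType) (F : nat -> M) N :
    (forall i, (N <= i)%N -> F i = 0) ->
  \sum_(i \in [set: nat]) F i = \sum_(i < N) F i.
Proof.
move=> F0; rewrite fsbig_ord; apply/esym/fsbig_widen => // i [_ /negP].
by rewrite -leqNgt => /F0.
Qed.

Lemma binz_small (m j : nat) : (m < j)%N -> binz K m%:Z j = 0.
Proof.
by move=> mj; rewrite /binz (bigD1 (Ordinal mj)) //= subrr !mul0r.
Qed.

Lemma binz0 m : binz K m 0 = 1.
Proof. by rewrite /binz big_ord0 fact0 divr1. Qed.

(** The Borcherds identity with m = 1 and n = 0: its left-hand side stops at
    the second term because binomial coefficients of 1 do, and its right-hand
    side at the first because binomial coefficients of 0 do. *)
Lemma mode_comm1 (a b c : V) (k : int) :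
  vmode a 1 (vmode b k c) - vmode b k (vmode a 1 c)
  = vmode (vmode a 0 b) (1 + k) c + vmode (vmode a 1 b) k c.
Proof.
have := borcherds a b c 1 0 k.
rewrite (fsum_nat_bounded (N := 2)) => [|i i2]; last first.
  by rewrite (@binz_small 1) // scale0r.
rewrite (fsum_nat_bounded (N := 1)) => [|i i1]; last first.
  by rewrite (@binz_small 0) // mulr0 scale0r.
rewrite !big_ord_recl !big_ord0 !addr0 !binz0 /= expr0 mulr1 !scale1r => E.
rewrite !add0r /bump leqnn addn0 in E.
rewrite -E /binz big_ord_recl big_ord0 subr0 mulr1 divr1 scale1r.
by rewrite [1 + k]addrC addrK.
Qed.

End Modes.

Section Grading.
Variables (K : numFieldType) (V : voaType K).
Local Notation L0 := (vmode (omega : V) 1).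

(** The term in L_(-1) of the commutator is absorbed by the derivation
    property, so that only the weight of a matters. *)
Lemma L0_mode (a c : V) (k : int) n : has_wt n a ->
  L0 (vmode a k c) = vmode a k (L0 c) + (n%:R - (1 + k)%:~R) *: vmode a k c.
Proof.
move=> an; apply/eqP; rewrite addrC -subr_eq mode_comm1 omega_derivation an.
have -> : vmode (n%:R *: a) k c = n%:R *: vmode a k c.
  by have := vmode_linear_l k c n%:R a 0; rewrite vmode0l !addr0.
by rewrite scalerBl [- _ + _]addrC [1 + k]addrC addrK.
Qed.

Lemma L0_vac : L0 vac = 0.
Proof. exact: (vmode_vac_nneg (omega : V) 1). Qed.

(** Eigenvectors of L_0 for distinct eigenvalues are independent: L_0 - N kills
    the last term of a vanishing sum and rescales the others by nonzero
    factors. *)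
Lemma weight_vectors_free (F : nat -> V) N :
    (forall n, has_wt n (F n)) -> \sum_(n < N) F n = 0 ->
  forall n, (n < N)%N -> F n = 0.
Proof.
elim: N F => [//|N IH] F F_wt F0.
have low n : (n < N)%N -> F n = 0.
  move=> nN; have : (n%:R - N%:R) *: F n = 0 :> V.
    apply: (IH (fun i => (i%:R - N%:R) *: F i)) nN => [i|].
      by rewrite /has_wt linearZ /= F_wt !scalerA mulrC.
    have := congr1 (fun v => L0 v - N%:R *: v) F0.
    rewrite /= linear0 scaler0 subr0 raddf_sum scaler_sumr -sumrB big_ord_recr /=.
    rewrite F_wt subrr addr0 => E; rewrite -[RHS]E; apply: eq_bigr => i _.
    by rewrite F_wt scalerBl.
  move=> /eqP; rewrite scaler_eq0 subr_eq0 eqr_nat => /orP[/eqP nE|/eqP //].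
  by rewrite nE ltnn in nN.
move=> n; rewrite ltnS leq_eqVlt => /orP[/eqP ->|]; last exact: low.
move: F0; rewrite big_ord_recr /= big1 ?add0r // => i _; exact: low.
Qed.

Lemma wt_comp_unique (F : nat -> V) N v :
    (forall n, has_wt n (F n)) -> (forall n, (N <= n)%N -> F n = 0) ->
    v = \sum_(n < N) F n ->
  forall n, wt_comp n v = F n.
Proof.
move=> F_wt FN vF n; have [M vM] := wt_comp_finite v.
pose D i := wt_comp i v - F i.
suff : D n = 0 by move/subr0_eq.
pose m := (maxn n.+1 (maxn M N)).
apply: (@weight_vectors_free D m) => [i||]; last by rewrite leq_max leqnn.
  by rewrite /has_wt linearB /= F_wt wt_compP scalerBr.
rewrite sumrB; apply/eqP; rewrite subr_eq0; apply/eqP.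
transitivity v.
  rewrite [RHS]wt_comp_sum (fsum_nat_bounded (N := m)) // => i.
  by rewrite !geq_max => /and3P[_ Mi _]; exact: vM.
rewrite vF -!(fsum_nat_bounded (F := F)) // => i.
by rewrite !geq_max => /and3P[_ _ Ni]; exact: FN.
Qed.

End Grading.

Section Embedded.
Variables (K : numFieldType) (V W : voaType K) (j : {linear V -> W}).
Hypotheses (hj : vertex_embedding j).
Hypothesis j_L0 : forall v, j (vmode omega 1 v) = vmode omega 1 (j v).

Lemma emb_has_wt n v : has_wt n v -> has_wt n (j v).
Proof. by move=> vn; rewrite /has_wt -j_L0 vn linearZ. Qed.

Lemma emb_wt_comp n v : wt_comp n (j v) = j (wt_comp n v).
Proof.
have [N vN] := wt_comp_finite v.
apply: (wt_comp_unique (F := fun n => j (wt_comp n v)) (N := N)) => [i|i Ni|].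
- by apply: emb_has_wt; exact: wt_compP.
- by rewrite vN // linear0.
by rewrite {1}[v]wt_comp_sum (fsum_nat_bounded (N := N)) // raddf_sum.
Qed.

Lemma emb_zhu_residue n d a b :
  j (zhu_residue n d a b) = zhu_residue n d (j a) (j b).
Proof.
have jZ c v : j (c *: v) = c *: j v by exact: linearZ.
rewrite /zhu_residue raddf_sum; apply: eq_bigr => i _.
by rewrite [LHS]jZ (emb_mode hj).
Qed.

Lemma zhu_residue0 (U : voaType K) n d (b : U) : zhu_residue n d 0 b = 0.
Proof.
rewrite /zhu_residue big1 // => i _.
by rewrite vmode0l scaler0.
Qed.

Lemma emb_zhu_mul a b : j (zhu_mul a b) = zhu_mul (j a) (j b).
Proof.
have [N aN] := wt_comp_finite a; rewrite /zhu_mul.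
rewrite !(fsum_nat_bounded (N := N)) => [|i Ni|i Ni].
- rewrite raddf_sum; apply: eq_bigr => i _.
  by rewrite emb_wt_comp -emb_zhu_residue.
- by rewrite emb_wt_comp aN // linear0 zhu_residue0.
by rewrite aN // zhu_residue0.
Qed.

(** An element a o b is computed from the weight of a and from modes, and the
    map preserves both. *)
Lemma zhu_map : exists q : {linear zhu V -> zhu W},
  forall v, q (zhu_class v) = zhu_class (j v).
Proof.
have killed s : @zhu_circ K V s -> (lclass (@zhu_circ K W) \o j) s = 0.
  move=> [n [a [b [an ->]]]].
  rewrite /= emb_zhu_residue -[RHS](raddf0 (lclass (@zhu_circ K W))).
  apply/lclassP; rewrite subr0; apply: span_gen; exists n, (j a), (j b).
  by split=> //; exact: emb_has_wt.
exact: (lquot_lift killed).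
Qed.

End Embedded.

(** A current J(x) has weight 1, so that its modes shift weights in the same
    way in both algebras; as the currents generate the source, a map that
    sends currents to currents intertwines the two operators L_0 even if it
    does not send one conformal vector to the other. *)
Lemma emb_currents_L0 (K : numFieldType) (L L' : lieAlgType K) (V W : voaType K)
    (J : L -> V) (J' : L' -> W) (g : L -> L') (j : {linear V -> W}) :
    vertex_embedding j -> (forall x, has_wt 1 (J x)) ->
    (forall x, has_wt 1 (J' x)) -> (forall x, j (J x) = J' (g x)) ->
    (forall v, generated J v) ->
  forall v, j (vmode omega 1 v) = vmode omega 1 (j v).
Proof.
move=> hj J1 J1' jJ gen v.
have jP c u w : j (c *: u + w) = c *: j u + j w by exact: linearP.
elim: {v}(gen v) => [|c u v _ IHu _ IHv|x n v _ IH].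
- by rewrite L0_vac linear0 (emb_vac hj) L0_vac.
- by rewrite linearP jP IHu IHv jP linearP.
rewrite (L0_mode _ _ (J1 x)) addrC jP !(emb_mode hj (J x)) IH jJ.
by rewrite (L0_mode _ _ (J1' _)) addrC.
Qed.

(** * Comparison with the Zhu algebras *)

Section Zhu.
Variables (K : numFieldType) (V1 V2 : voaType K).
Variables (J1 : sl K 2 -> V1) (J2 : sl K 3 -> V2).
Hypothesis hV1 : simple_affine_voa (@trace_form K 2) J1 1.
Hypothesis hV2 : simple_affine_voa (@trace_form K 3) J2 1.
Variable j : {linear V1 -> V2}.
Hypotheses (j_e : j (J1 (sl2_e K)) = J2 (sl3_xa K))
  (j_f : j (J1 (sl2_f K)) = J2 (sl3_xma K))
  (j_h : j (J1 (sl2_h K)) = J2 (sl3_x K)).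

(** The three values given on the standard basis determine the map on all
    currents. *)
Lemma emb_current A : j (J1 A) = J2 (sl_corner A).
Proof.
have jP c u w : j (c *: u + w) = c *: j u + j w by exact: linearP.
have jZ c u : j (c *: u) = c *: j u by exact: linearZ.
have J1P := current_linear hV1; have J2P := current_linear hV2.
rewrite [A]sl2_span !J1P !jP j_e j_h !linearP /= sl_corner_e sl_corner_h.
rewrite linearZ /= sl_corner_f !J2P (scalable_linear J1P) (scalable_linear J2P).
by rewrite jZ j_f.
Qed.

Hypothesis hj : vertex_embedding j.
Variable phi1 : {linear aquot (sqr_gens (sl2_e K)) -> zhu V1}.
Variable phi2 : {linear aquot (sqr_gens (sl3_xab K)) -> zhu V2}.
Hypotheses (hphi1 : morphism_to_zhu phi1) (hphi2 : morphism_to_zhu phi2).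
Hypothesis phi1_env : forall a, phi1 (aclass _ (env a)) = zhu_class (J1 a).
Hypothesis phi2_env : forall a, phi2 (aclass _ (env a)) = zhu_class (J2 a).
Variable iota : {lrmorphism envalg (sl K 2) -> envalg (sl K 3)}.
Hypothesis iotaE : forall A, iota (env A) = env (sl_corner A).
Variable pi : {lrmorphism aquot (sqr_gens (sl2_e K))
                          -> aquot (sqr_gens (sl3_xab K))}.
Hypothesis piE : forall u, pi (aclass _ u) = aclass _ (iota u).

Lemma current_L0 v : j (vmode omega 1 v) = vmode omega 1 (j v).
Proof.
exact: (emb_currents_L0 hj (current_wt hV1) (current_wt hV2) emb_current
  (current_generated hV1)).
Qed.

(** Both composites are linear, send 1 to the class of the vacuum and turn left
    multiplication by x into multiplication by the class of the current of the
    image of x; products of elements of sl_2 span the source. *)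
Lemma zhu_map_square (q : {linear zhu V1 -> zhu V2}) :
    (forall v, q (zhu_class v) = zhu_class (j v)) ->
  forall u, q (phi1 u) = phi2 (pi u).
Proof.
move=> qE u; rewrite -[u]aclass_repr; elim/env_ind: (aquot_repr u) => {u}
    [|c u v IHu IHv|A u IH].
- have -> : aclass (sqr_gens (sl2_e K)) 1 = 1 by [].
  have -> : pi 1 = 1 by exact: rmorph1.
  by rewrite (to_zhu_one hphi1) (to_zhu_one hphi2) qE (emb_vac hj).
- have clP x y : aclass (sqr_gens (sl2_e K)) (c *: x + y)
      = c *: aclass (sqr_gens (sl2_e K)) x + aclass (sqr_gens (sl2_e K)) y.
    exact: linearP.
  have phi1P x y : phi1 (c *: x + y) = c *: phi1 x + phi1 y by exact: linearP.
  have phi2P x y : phi2 (c *: x + y) = c *: phi2 x + phi2 y by exact: linearP.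
  have piP x y : pi (c *: x + y) = c *: pi x + pi y by exact: linearP.
  have qP x y : q (c *: x + y) = c *: q x + q y by exact: linearP.
  rewrite (clP u v) (phi1P (aclass _ u) (aclass _ v)) qP.
  by rewrite (piP (aclass _ u) (aclass _ v)) phi2P IHu IHv.
have -> : aclass (sqr_gens (sl2_e K)) (env A * u)
    = aclass (sqr_gens (sl2_e K)) (env A) * aclass (sqr_gens (sl2_e K)) u.
  exact: rmorphM.
set w := aclass _ u in IH *.
have piM x y : pi (x * y) = pi x * pi y by exact: rmorphM.
pose b : V1 := repr (phi1 w : lquot _).
have phi1w : phi1 w = zhu_class b by exact/esym/lclass_repr.
rewrite (to_zhu_mul hphi1 (phi1_env A) phi1w) qE (emb_zhu_mul hj current_L0).
rewrite emb_current piM piE iotaE; apply/esym.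
apply: (to_zhu_mul hphi2); first exact: phi2_env.
by rewrite -IH phi1w qE.
Qed.

End Zhu.
Theorem proposition4p1 (R : realType)
    (* V1 and V2 are V_(A_1) = L_(sl_2)(1,0) and V_(A_2) = L_(sl_3)(1,0) *)
    (V1 V2 : voaType R[i])
    (J1 : sl R[i] 2 -> V1) (J2 : sl R[i] 3 -> V2)
    (hV1 : simple_affine_voa (@trace_form R[i] 2) J1 1)
    (hV2 : simple_affine_voa (@trace_form R[i] 3) J2 1)
    (* the known descriptions of their Zhu algebras *)
    (phi1 : {linear aquot (sqr_gens (sl2_e R[i])) -> zhu V1})
    (phi2 : {linear aquot (sqr_gens (sl3_xab R[i])) -> zhu V2})
    (hphi1 : morphism_to_zhu phi1) (hphi2 : morphism_to_zhu phi2)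
    (phi1_bij : bijective phi1) (phi2_bij : bijective phi2)
    (phi1_env : forall a, phi1 (aclass _ (env a)) = zhu_class (J1 a))
    (phi2_env : forall a, phi2 (aclass _ (env a)) = zhu_class (J2 a))
    (* the embedding of V_(A_1) into V_(A_2) *)
    (j : {linear V1 -> V2}) (hj : vertex_embedding j)
    (j_e : j (J1 (sl2_e R[i])) = J2 (sl3_xa R[i]))
    (j_f : j (J1 (sl2_f R[i])) = J2 (sl3_xma R[i]))
    (j_h : j (J1 (sl2_h R[i])) = J2 (sl3_x R[i])) :
  exists iota : {lrmorphism envalg (sl R[i] 2) -> envalg (sl R[i] 3)},
    [/\ injective iota,
        forall r s t : nat,
          iota (env (sl2_e R[i]) ^+ r * env (sl2_h R[i]) ^+ s
                * env (sl2_f R[i]) ^+ t)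
          = env (sl3_xa R[i]) ^+ r * env (sl3_x R[i]) ^+ s
            * env (sl3_xma R[i]) ^+ t
      & exists pi : {lrmorphism aquot (sqr_gens (sl2_e R[i]))
                                -> aquot (sqr_gens (sl3_xab R[i]))},
        [/\ forall u, pi (aclass _ u) = aclass _ (iota u),
            injective pi,
            [/\ pi (aclass _ (env (sl2_e R[i]))) = aclass _ (env (sl3_xa R[i])),
                pi (aclass _ (env (sl2_f R[i]))) = aclass _ (env (sl3_xma R[i]))
              & pi (aclass _ (env (sl2_h R[i]))) = aclass _ (env (sl3_x R[i]))]
          & exists piA : {linear zhu V1 -> zhu V2},
            [/\ zhu_morphism piA,
                forall v, piA (zhu_class v) = zhu_class (j v),
                injective piA
              & forall u, piA (phi1 u) = phi2 (pi u)]]].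
Proof.
have [iota iotaE] := env_corner_lift R[i].
have [pi piE] := aquot_corner_lift iotaE.
have iota_e : iota (env (sl2_e R[i])) = env (sl3_xa R[i]).
  by rewrite iotaE sl_corner_e.
have iota_f : iota (env (sl2_f R[i])) = env (sl3_xma R[i]).
  by rewrite iotaE sl_corner_f.
have iota_h : iota (env (sl2_h R[i])) = env (sl3_x R[i]).
  by rewrite iotaE sl_corner_h.
exists iota; split; first exact: env_corner_inj iotaE.
  have iotaM u v : iota (u * v) = iota u * iota v by exact: rmorphM.
  have iotaX u n : iota (u ^+ n) = iota u ^+ n by exact: rmorphXn.
  move=> r s t.
  rewrite (iotaM (_ * _) (_ ^+ t)) (iotaM (_ ^+ r) (_ ^+ s)).
  by rewrite (iotaX _ r) (iotaX _ s) (iotaX _ t) iota_e iota_h iota_f.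
have pi_inj := aquot_corner_inj iotaE piE.
exists pi; split=> //; first by split; rewrite piE ?iota_e ?iota_f ?iota_h.
have L0 := current_L0 hV1 hV2 j_e j_f j_h hj.
have [q qE] := zhu_map hj L0.
have sq := zhu_map_square hV1 hV2 j_e j_f j_h hj hphi1 hphi2 phi1_env phi2_env
  iotaE piE qE.
have [psi1 phi1K psi1K] := phi1_bij.
exists q; split=> //.
- split; first by rewrite qE (emb_vac hj).
  move=> a b a' b' qa qb.
  have h1 : phi1 (psi1 (zhu_class a)) = zhu_class a by exact: psi1K.
  have h2 : phi1 (psi1 (zhu_class b)) = zhu_class b by exact: psi1K.
  rewrite -(to_zhu_mul hphi1 h1 h2) sq.
  have piM x y : pi (x * y) = pi x * pi y by exact: rmorphM.
  by rewrite piM; apply: (to_zhu_mul hphi2); rewrite -sq psi1K.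
- move=> x y; rewrite -[x]psi1K -[y]psi1K !sq => /(bij_inj phi2_bij)/pi_inj.
  by move->.
Qed.
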